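(* Let $\mathcal A$ be the antitree with sphere numbers $s_n=n+1$, $n\ge0$. Then for each $N\in\mathbb Z_{\ge1}\cup\{\infty\}$ there are edge lengths such that the corresponding minimal Kirchhoff Laplacian $\mathbf H_0$ has deficiency indices $\mathrm n_\pm(\mathbf H_0)=N$.
   Context: Antitrees. Let $\mathcal G_d=(\mathcal V,\mathcal E)$ be a connected simple graph with a fixed root $o\in\mathcal V$, and let $S_n$, $n\ge0$, be the combinatorial spheres around $o$ (so $S_0=\{o\}$). $\mathcal G_d$ is an antitree if every vertex in $S_n$, $n\ge1$, is connected by an edge to all vertices in $S_{n-1}$ and in $S_{n+1}$, and to no vertices in $S_k$ for $|k-n|\ne1$. An antitree is uniquely determined by its sphere numbers $s_n=\#S_n$. Metric graphs. Given edge lengths $|e|\in(0,\infty)$, $e\in\mathcal E$, the metric graph is the topological space obtained by identifying each edge $e$ with the interval $[0,|e|]$ and gluing together endpoints corresponding to the same vertex; call it $\mathcal G$. $\mathcal E_v$ is the set of edges incident to $v$; a function $f$ on $\mathcal G$ has edge components $f_e=f|_e$; $f_e'(v)$ denotes the derivative of $f_e$ at the vertex $v$ of $e$ taken in the direction pointing from $v$ into $e$. $L^2(\mathcal G)=\bigoplus_eL^2(e)$ with respect to Lebesgue measure. Operators. The maximal Kirchhoff Laplacian $\mathbf H$ in $L^2(\mathcal G)$ acts by $f\mapsto -f''$ edgewise on the domain of all $f\in L^2(\mathcal G)$ with $f_e\in H^2(e)$ for all $e$, $f''\in L^2(\mathcal G)$, and satisfying at every vertex $v$ the Kirchhoff conditions: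 $f$ is continuous at $v$ and $\sum_{e\in\mathcal E_v}f_e'(v)=0$. $\mathbf H_0^0$ is its restriction to functions that are non-zero only on finitely many edges, and the minimal Kirchhoff Laplacian $\mathbf H_0$ is the closure of $\mathbf H_0^0$; it is symmetric and non-negative, with $\mathbf H_0^*=\mathbf H$. The deficiency indices are $\mathrm n_\pm(\mathbf H_0)=\dim\ker(\mathbf H\mp\mathrm i)$ (with value $\infty$ if infinite-dimensional), which are equal to each other. *)

(* Defs.v *)
(* MathComp and MathComp-Analysis; complex numbers are R[i] of real-closed. *)
From HB Require Import structures.
From mathcomp Require Import all_boot all_order all_algebra.
From mathcomp Require Import complex.
From mathcomp Require Import all_classical all_reals all_analysis.
From mathcomp Require Import zify.

Set Implicit Arguments.
Unset Strict Implicit.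
Unset Printing Implicit Defensive.

Import Order.TTheory GRing.Theory Num.Theory.
Import numFieldNormedType.Exports.

Local Open Scope classical_set_scope.
Local Open Scope ring_scope.

(* Every edge carries an auxiliary orientation, which is only used to identify
   it with an interval: src e is glued to 0 and tgt e to the right endpoint.
   Adjacency and all the graph-theoretic notions ignore it. *)
Record ograph := OGraph {
  vertex : choiceType ;
  edge : choiceType ;
  src : edge -> vertex ;
  tgt : edge -> vertex }.

Section Graphs.
Variable G : ograph.
Implicit Types (v w : vertex G) (e : edge G).

Definition joins e v w :=
  (src e = v /\ tgt e = w) \/ (src e = w /\ tgt e = v).

Definition adjacent v w := exists e, joins e v w.

Definition simple_graph :=
  (forall e, src e <> tgt e) /\
  (forall e1 e2 v w, joins e1 v w -> joins e2 v w -> e1 = e2).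

Definition locally_finite :=
  forall v, finite_set [set e | src e = v \/ tgt e = v].

Fixpoint walk n v w : Prop :=
  if n is m.+1 then exists2 u, adjacent v u & walk m u w else v = w.

Definition connected_graph := forall v w, exists n, walk n v w.

Definition sphere v n : set (vertex G) :=
  [set w | walk n v w /\ forall m, (m < n)%N -> ~ walk m v w].

Definition is_antitree v :=
  [/\ connected_graph, simple_graph &
      forall n k w1 w2, sphere v n w1 -> sphere v k w2 ->
        (adjacent w1 w2 <-> n = k.+1 \/ k = n.+1)].

End Graphs.

(* The n-th sphere is the fibre of tag over n; the edge (n, (i, j)) joins the
   i-th vertex of sphere n to the j-th vertex of sphere n.+1. *)
Definition antitree (s : nat -> nat) : ograph :=
  @OGraph {n : nat & 'I_(s n)} {n : nat & ('I_(s n) * 'I_(s n.+1))%type}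
    (fun e => Tagged (fun n => 'I_(s n)) (tagged e).1)
    (fun e => @Tagged nat (tag e).+1 (fun n => 'I_(s n)) (tagged e).2).

Section AntitreeSanity.
Variable s : nat -> nat.
Hypotheses (s0 : s 0 = 1%N) (s_gt0 : forall n, (0 < s n)%N).
Notation G := (antitree s).
Implicit Types v w o : vertex G.

Lemma antitree_adjP v w :
  adjacent v w <-> tag v = (tag w).+1 \/ tag w = (tag v).+1.
Proof.
split=> [[e [[<- <-]|[<- <-]]]|]; [by right|by left|].
case: v w => [n i] [m j] /= [E|E].
  subst n; exists (@Tagged nat m (fun n => ('I_(s n) * 'I_(s n.+1))%type) (j, i)).
  by right.
subst m; exists (@Tagged nat n (fun n => ('I_(s n) * 'I_(s n.+1))%type) (i, j)).
by left.
Qed.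

Lemma antitree_walk_tag n v w : walk n v w ->
  (tag w <= tag v + n)%N /\ (tag v <= tag w + n)%N.
Proof.
elim: n v => [|n IH] v /=; first by move=> ->; rewrite addn0.
move=> [u /antitree_adjP vu /IH [uw wu]].
by move: (tag v) (tag u) (tag w) vu uw wu => a b c; lia.
Qed.

Lemma antitree_walk_up o v : tag o = 0%N -> walk (tag v) o v.
Proof.
move=> o0.
suff H n (u : vertex G) : (tag v = tag u + n.+1)%N -> walk n.+1 u v.
  case: v H => [[|n] i] H; last by apply: H; rewrite o0.
  case: o o0 H => m j /= m0 _; subst m; congr (Tagged _ _).
  by apply/val_inj => /=; move: i j; rewrite s0 => i j; rewrite !ord1.
elim: n u => [|n IH] u E /=.
  by exists v => //; apply/antitree_adjP; right; rewrite E addn1.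
exists (@Tagged nat (tag u).+1 (fun n => 'I_(s n)) (Ordinal (s_gt0 (tag u).+1))).
  by apply/antitree_adjP; right.
by apply: IH; rewrite E /= addSn addnS.
Qed.

Lemma walk_rcons n v w u : walk n v w -> adjacent w u -> walk n.+1 v u.
Proof.
elim: n v => [|n IH] v /=; first by move=> -> wu; exists u.
by move=> [x vx xw] wu; exists x => //; exact: IH.
Qed.

Lemma walk_sym n v w : walk n v w -> walk n w v.
Proof.
elim: n v => [|n IH] v; first by move=> /= ->.
move=> [x vx /IH wx]; apply: walk_rcons wx _.
by case: vx => e [H|H]; exists e; [right|left].
Qed.

Lemma walk_trans n m v w u : walk n v w -> walk m w u -> walk (n + m) v u.
Proof.
elim: n v => [|n IH] v /=; first by move=> ->.
by move=> [x vx xw] wu; exists x => //; exact: IH.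
Qed.

Lemma antitree_sphereE o n : tag o = 0%N ->
  sphere o n = [set v | tag v = n].
Proof.
move=> o0; apply/seteqP; split=> v /=.
  move=> [ov nov]; apply/eqP; rewrite eqn_leq.
  have /= := (antitree_walk_tag ov).1; rewrite o0 add0n => -> /=.
  by rewrite leqNgt; apply/negP => /nov; apply; exact: antitree_walk_up.
move=> <-; split=> [|m mn /antitree_walk_tag[]]; first exact: antitree_walk_up.
by rewrite o0 add0n leqNgt mn.
Qed.

Lemma antitreeP o : tag o = 0%N -> is_antitree o.
Proof.
move=> o0; split=> [v w| |n k v w].
- exists (tag v + tag w)%N; apply: (@walk_trans _ _ _ o).
    exact/walk_sym/antitree_walk_up.
  exact: antitree_walk_up.
- split=> [e /(congr1 tag) /= /n_Sn //|].
  move=> [n1 [i1 j1]] [n2 [i2 j2]] v w; rewrite /joins /=.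
  move=> [[<- <-]|[<- <-]] [[]|[]] E1 E2;
  have /= T1 := congr1 tag E1; have /= T2 := congr1 tag E2; try lia; subst n2;
  move: E1 E2 => /eqP; rewrite eq_Tagged => /eqP /= -> /eqP;
  by rewrite eq_Tagged => /eqP /= ->.
- rewrite !antitree_sphereE //= => <- <-; exact: antitree_adjP.
Qed.

Lemma antitree_sphere_card o n : tag o = 0%N ->
  (sphere o n #= [set: 'I_(s n)])%card.
Proof.
move=> o0; rewrite antitree_sphereE //.
have -> : [set v : vertex G | tag v = n] =
    Tagged (fun n => 'I_(s n)) @` [set: 'I_(s n)].
  apply/seteqP; split=> v /=; last by move=> [i _ <-].
  by case: v => m i /= E; subst m; exists i.
apply: inj_card_eq => i j _ _ /eqP; rewrite eq_Tagged => /eqP //.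
Qed.

Lemma antitree_locally_finite : locally_finite G.
Proof.
move=> v.
pose E n := Tagged (fun n => ('I_(s n) * 'I_(s n.+1))%type) @`
              [set: ('I_(s n) * 'I_(s n.+1))%type].
apply: (@sub_finite_set _ _ (E (tag v) `|` E (tag v).-1)); last first.
  by rewrite finite_setU; split; apply: finite_image; exact: finite_finset.
move=> [n p] /= [<-|<-]; [left|right]; by exists p.
Qed.

End AntitreeSanity.

Section KirchhoffLaplacian.
Variables (R : realType) (G : ograph) (ell : edge G -> R).
Notation C := R[i].
Notation mu := (@lebesgue_measure R).

(* A function on the metric graph is given by its edge components; f e x is
   meaningful only for 0 <= x <= ell e. *)
Definition gfun := edge G -> R -> C.
Implicit Types f g h : gfun.

Definition abs2 (z : C) : R := complex.Re z ^+ 2 + complex.Im z ^+ 2.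

Definition cmeasurable (D : set R) (u : R -> C) :=
  measurable_fun D (fun x => complex.Re (u x)) /\
  measurable_fun D (fun x => complex.Im (u x)).

Definition cintegrable (D : set R) (u : R -> C) :=
  mu.-integrable D (fun x => (complex.Re (u x))%:E) /\
  mu.-integrable D (fun x => (complex.Im (u x))%:E).

Definition cintegral (D : set R) (u : R -> C) : C :=
  ((\int[mu]_(x in D) complex.Re (u x)) +i*
   (\int[mu]_(x in D) complex.Im (u x)))%C.

Definition L2norm2 f : \bar R :=
  (\esum_(e in [set: edge G])
     \int[mu]_(x in `[0%R, ell e]) (abs2 (f e x))%:E)%E.

Definition in_L2 f :=
  (forall e, cmeasurable `[0, ell e] (f e)) /\ (L2norm2 f < +oo)%E.

(* u is absolutely continuous on [0, l] with (a.e.) derivative u'. *)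
Definition AC_deriv (l : R) (u u' : R -> C) :=
  cintegrable `[0, l] u' /\
  forall x, 0 <= x <= l -> u x = u 0 + cintegral `[0, x] u'.

(* u is (the continuous representative of) an element of H^2(0, l), with
   derivatives u1 and u2. As u1 is continuous on [0, l], it is the classical
   derivative of u there, one-sided at the endpoints, and it is determined
   by u on all of [0, l]. *)
Definition H2_deriv (l : R) (u u1 u2 : R -> C) :=
  [/\ AC_deriv l u u1, AC_deriv l u1 u2, cmeasurable `[0, l] u2 &
      (\int[mu]_(x in `[0%R, l]) (abs2 (u2 x))%:E < +oo)%E].

Definition continuous_at_vertex f (v : vertex G) :=
  exists c : C,
    (forall e, src e = v -> f e 0 = c) /\
    (forall e, tgt e = v -> f e (ell e) = c).

(* f1 is the edgewise derivative along the orientation, so the derivative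
   pointing into e is f1 e 0 at src e and - f1 e (ell e) at tgt e. The sums
   are finite on locally finite graphs. *)
Definition derivative_sum_at f1 (v : vertex G) : C :=
  \sum_(e \in [set e | src e = v]) f1 e 0
  - \sum_(e \in [set e | tgt e = v]) f1 e (ell e).

(* Unbounded operators in L^2(G) are given by their graphs. *)
Definition operator := gfun -> gfun -> Prop.

(* H f = g *)
Definition max_laplacian : operator := fun f g =>
  [/\ in_L2 f, in_L2 g &
      exists f1, (forall e, H2_deriv (ell e) (f e) (f1 e) (fun x => - g e x)) /\
        (forall v, continuous_at_vertex f v /\ derivative_sum_at f1 v = 0)].

Definition premin_laplacian : operator := fun f g =>
  max_laplacian f g /\
  finite_set [set e | exists2 x, 0 <= x <= ell e & f e x != 0].

Definition closure_op (T : operator) : operator := fun f g =>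
  [/\ in_L2 f, in_L2 g &
      forall eps : R, 0 < eps -> exists u w, [/\ T u w,
        (L2norm2 (fun e x => (f e x - u e x)%R) < eps%:E)%E &
        (L2norm2 (fun e x => (g e x - w e x)%R) < eps%:E)%E]].

Definition min_laplacian : operator := closure_op premin_laplacian.

Definition ker_shift (T : operator) (z : C) : set gfun :=
  [set f | T f (fun e x => z * f e x)].

Definition lin_comb n (c : 'I_n -> C) (F : 'I_n -> gfun) : gfun :=
  fun e x => \sum_(i < n) c i * F i e x.

(* Equality on the metric graph. For functions that are continuous on the
   closed edges, such as those in the domain of max_laplacian, it is the same
   as equality in L^2. *)
Definition eq_gfun f g :=
  forall e x, 0 <= x <= ell e -> f e x = g e x.

Definition lin_indep n (F : 'I_n -> gfun) :=
  forall c : 'I_n -> C, eq_gfun (lin_comb c F) (fun _ _ => 0) ->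
    forall i, c i = 0.

(* The dimension of K modulo eq_gfun; None stands for infinity. *)
Definition has_dim (K : set gfun) (N : option nat) :=
  match N with
  | Some n => exists F : 'I_n -> gfun,
      [/\ forall i, K (F i), lin_indep F &
          forall f, K f -> exists c : 'I_n -> C, eq_gfun f (lin_comb c F)]
  | None => forall n, exists F : 'I_n -> gfun,
      (forall i, K (F i)) /\ lin_indep F
  end.

(* Both deficiency indices of min_laplacian are N: since the adjoint of
   min_laplacian is max_laplacian, they are the dimensions of the kernels of
   max_laplacian - i and max_laplacian + i. *)
Definition min_laplacian_deficiency_indices (N : option nat) :=
  has_dim (ker_shift max_laplacian (0 +i* 1)%C) N /\
  has_dim (ker_shift max_laplacian (0 -i* 1)%C) N.

End KirchhoffLaplacian.

(* Main.v *)
(* A function in the kernel of H -+ i is determined on an edge of length l by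
   its end values, and the Kirchhoff conditions become a discrete equation with
   off-diagonal coefficients 1 / S(l) and diagonal ones C(l) / S(l), where C and
   S are the fundamental solutions of - f'' = +- i f.

   Label the i-th vertex of every sphere by g i, where g i = min(i, N - 1), or
   g i = i if N is infinite. Between two consecutive spheres an edge is short
   if its endpoints have the same label and eight times longer otherwise. The
   equation at a vertex depends on its label only, apart from its own value,
   and the sum of the diagonal coefficients is nonzero, so solutions are constant
   on label classes in each sphere. The values on a sphere then determine those
   on the next one, up to one free value whenever a new label appears, so
   that the solution space is parametrized by the labels.

   Each step multiplies the size of a solution by a factor that is polynomial
   in the sphere index and does not depend on the lengths. Lengths that
   decay fast enough therefore make all solutions square integrable. *)
Require Import Defs.
From mathcomp Require Import all_boot all_order all_algebra.
From mathcomp Require Import complex.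
From mathcomp Require Import all_classical all_reals all_analysis.
From mathcomp Require Import measurable_realfun ring lra zify.
Import Order.TTheory GRing.Theory Num.Theory.
Local Open Scope ring_scope.

Set Implicit Arguments.
Unset Strict Implicit.
Unset Printing Implicit Defensive.
Import numFieldNormedType.Exports.
Local Open Scope classical_set_scope.
Import ComplexField.Normc.

(** * Fundamental solutions of the edge equation *)

Section FundamentalSolutions.
Context {R : realType}.
Implicit Types x l M : R.

(* With k = (1 - i s) / sqrt 2, cosh (k x) = re_cosh x - i s im_cosh x and
   sinh (k x) / k = re_sinh x + i s im_sinh x for s = 1 and s = -1; the real
   functions do not depend on s. *)
Let al : R := (Num.sqrt 2)^-1.

Let al_sqr : al ^+ 2 * 2 = 1.
Proof. by rewrite exprVn sqr_sqrtr ?mulVf // ?ler0n ?pnatr_eq0. Qed.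

Let ch x := (expR (al * x) + expR (- (al * x))) / 2.
Let sh x := (expR (al * x) - expR (- (al * x))) / 2.

Definition re_cosh x := ch x * cos (al * x).
Definition im_cosh x := sh x * sin (al * x).
Definition re_sinh x := al * (sh x * cos (al * x) + ch x * sin (al * x)).
Definition im_sinh x := al * (sh x * cos (al * x) - ch x * sin (al * x)).

Let derive_ch x : is_derive x 1 ch (al * sh x).
Proof.
apply: is_derive_eq.
by rewrite /sh /GRing.scale /=; ring.
Qed.

Let derive_sh x : is_derive x 1 sh (al * ch x).
Proof. by apply: is_derive_eq; rewrite /ch /GRing.scale /=; ring. Qed.

Lemma derive_re_cosh x : is_derive x 1 re_cosh (im_sinh x).
Proof.
have dc := derive_ch x; have ds := derive_sh x; rewrite /re_cosh.
apply: is_derive_eq; rewrite /im_sinh /GRing.scale /=; ring.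
Qed.

Lemma derive_im_cosh x : is_derive x 1 im_cosh (re_sinh x).
Proof.
have dc := derive_ch x; have ds := derive_sh x; rewrite /im_cosh.
apply: is_derive_eq; rewrite /re_sinh /GRing.scale /=; ring.
Qed.

Lemma derive_re_sinh x : is_derive x 1 re_sinh (re_cosh x).
Proof.
have dc := derive_ch x; have ds := derive_sh x; rewrite /re_sinh.
apply: is_derive_eq; rewrite /re_cosh /GRing.scale /=.
by rewrite -[RHS]mul1r -[X in _ = X * _]al_sqr; ring.
Qed.

Lemma derive_im_sinh x : is_derive x 1 im_sinh (- im_cosh x).
Proof.
have dc := derive_ch x; have ds := derive_sh x; rewrite /im_sinh.
apply: is_derive_eq; rewrite /im_cosh /GRing.scale /=.
by rewrite -[RHS]mul1r -[X in _ = X * _]al_sqr; ring.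
Qed.

Lemma re_cosh0 : re_cosh 0 = 1.
Proof. by rewrite /re_cosh /ch mulr0 oppr0 expR0 cos0; field. Qed.
Lemma im_cosh0 : im_cosh 0 = 0.
Proof. by rewrite /im_cosh mulr0 sin0 mulr0. Qed.
Lemma re_sinh0 : re_sinh 0 = 0.
Proof. by rewrite /re_sinh /sh mulr0 oppr0 sin0 subrr mul0r mul0r mulr0 addr0 mulr0. Qed.
Lemma im_sinh0 : im_sinh 0 = 0.
Proof. by rewrite /im_sinh /sh mulr0 oppr0 sin0 subrr mul0r mul0r mulr0 subr0 mulr0. Qed.

Let hyperbolic_identity x : ch x ^+ 2 - sh x ^+ 2 = 1.
Proof.
have E : expR (al * x) * expR (- (al * x)) = 1 by rewrite -expRD subrr expR0.
by rewrite -[RHS]E /ch /sh; field.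
Qed.

(** This and [im_wronskian] are the real and imaginary parts of $\cosh^2-\sinh^2=1$ at $kx$;
    [wronskian_k] reassembles them. *)
Lemma re_wronskian x :
  re_cosh x ^+ 2 - im_cosh x ^+ 2 - 2 * re_sinh x * im_sinh x = 1.
Proof.
have -> : 2 * re_sinh x * im_sinh x = (al ^+ 2 * 2) *
   ((sh x * cos (al * x)) ^+ 2 - (ch x * sin (al * x)) ^+ 2).
  by rewrite /re_sinh /im_sinh; ring.
rewrite al_sqr mul1r /re_cosh /im_cosh -[RHS](hyperbolic_identity x).
by rewrite -[RHS]mulr1 -[X in _ = _ * X](cos2Dsin2 (al * x)); ring.
Qed.

Lemma im_wronskian x :
  re_sinh x ^+ 2 - im_sinh x ^+ 2 = 2 * re_cosh x * im_cosh x.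
Proof.
rewrite /re_sinh /im_sinh /re_cosh /im_cosh -[RHS]mul1r -[X in _ = X * _]al_sqr; ring.
Qed.

(** Mean value inequality. Applied in turn along the derivative formulas, it turns the constant
    bound on the cosh functions into bounds of order $x$, $x^2$ and $x^3$, each time with the
    constant 2. *)
Lemma derivative_bound (f f' : R -> R) l M : 0 <= l ->
  (forall x, is_derive x 1 f (f' x)) ->
  (forall x, 0 <= x <= l -> `|f' x| <= M) -> `|f l - f 0| <= M * l.
Proof.
move=> l0 df bnd.
have [|c cl ->] := MVT_segment l0 (fun x _ => df x).
  by apply: derivable_within_continuous => x _; have [] := df x.
by rewrite subr0 normrM (ger0_norm l0) ler_wpM2r // bnd // -in_itv.
Qed.

Let al_bounds : 0 < al <= 1.
Proof.
have al0 : 0 < al by rewrite invr_gt0 sqrtr_gt0 ltr0n.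
by rewrite al0 /=; have := al_sqr; nra.
Qed.

Let expR_bound (y : R) : `|y| <= 1 / 2 -> 0 < expR y <= 2.
Proof.
move=> yb; rewrite expR_gt0 /=.
(* Here $e^{-y}\ge1-y\ge1/2$, and $e^y$ is its reciprocal. *)
have := expR_ge1Dx (- y); have := expR_gt0 (- y).
have : expR y * expR (- y) = 1 by rewrite -expRD subrr expR0.
have := expR_gt0 y; move: yb; rewrite ler_norml => /andP[].
by move: (expR y) (expR (- y)) => u v; nra.
Qed.

Let ch_sh_bound x : 0 <= x <= 1 / 2 -> `|ch x| <= 2 /\ `|sh x| <= 2.
Proof.
move=> x01.
have ab : `|al * x| <= 1 / 2.
  by rewrite ger0_norm; have := al_bounds; nra.
have := expR_bound ab; have := @expR_bound (- (al * x)).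
rewrite normrN => /(_ ab); rewrite /ch /sh.
move: (expR _) (expR _) => u v /andP[u0 u1] /andP[v0 v1].
by split; rewrite ler_norml; apply/andP; split; lra.
Qed.

Let prod_bound (u v : R) : `|u| <= 2 -> `|v| <= 1 -> `|u * v| <= 2.
Proof. by move=> u2 v1; rewrite normrM -[2]mulr1 ler_pM. Qed.

Let cosh_bound x : 0 <= x <= 1 / 2 -> `|re_cosh x| <= 2 /\ `|im_cosh x| <= 2.
Proof.
move=> /ch_sh_bound[hc hs].
by split; apply: prod_bound => //; rewrite ?cos_max ?sin_max.
Qed.

Let sinh_bound x : 0 <= x <= 1 / 2 ->
  `|re_sinh x| <= 2 * x /\ `|im_sinh x| <= 2 * x.
Proof.
move=> /andP[x0 x1].
have := derivative_bound (M := 2) x0 derive_im_sinh.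
have := derivative_bound (M := 2) x0 derive_re_sinh.
rewrite re_sinh0 im_sinh0 !subr0 => Hr Hi.
by split; [apply: Hr|apply: Hi] => y /andP[y0 yx];
  have [] := @cosh_bound y _; rewrite ?normrN //; lra.
Qed.

Lemma cosh_near1 x : 0 <= x <= 1 / 2 ->
  `|re_cosh x - 1| <= 2 * x ^+ 2 /\ `|im_cosh x| <= 2 * x ^+ 2.
Proof.
move=> /andP[x0 x1]; rewrite expr2 mulrA.
have := derivative_bound (M := 2 * x) x0 derive_im_cosh.
have := derivative_bound (M := 2 * x) x0 derive_re_cosh.
rewrite re_cosh0 im_cosh0 !subr0 => Hr Hi.
by split; [apply: Hr|apply: Hi] => y /andP[y0 yx];
  have [] := @sinh_bound y _; lra.
Qed.

Lemma sinh_near_id x : 0 <= x <= 1 / 2 ->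
  `|re_sinh x - x| <= 2 * x ^+ 3 /\ `|im_sinh x| <= 2 * x ^+ 3.
Proof.
move=> /andP[x0 x1].
have -> : 2 * x ^+ 3 = 2 * x ^+ 2 * x by ring.
have D (y : R) : is_derive y 1 (fun t : R => re_sinh t - t) (re_cosh y - 1).
  by have := derive_re_sinh y => ?; apply: is_deriveB.
have mono (y : R) : 0 <= y <= x -> 2 * y ^+ 2 <= 2 * x ^+ 2 by nra.
have := derivative_bound (M := 2 * x ^+ 2) x0 derive_im_sinh.
have := derivative_bound (M := 2 * x ^+ 2) x0 D.
rewrite re_sinh0 im_sinh0 !subr0 => Hr Hi.
split; [apply: Hr|apply: Hi] => y yx; have := mono _ yx;
  have [] := @cosh_near1 y _; rewrite ?normrN; lra.
Qed.

End FundamentalSolutions.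

(** * Componentwise calculus of complex-valued functions and absolute continuity *)

Section EdgeSolutions.
Context {R : realType}.
Notation C := R[i].
Notation mu := (@lebesgue_measure R).
Implicit Types (s x l M : R) (u v w : R -> C).

Definition complex_derive u v :=
  (forall x, is_derive x 1 (@complex.Re R \o u) (complex.Re (v x))) /\
  (forall x, is_derive x 1 (@complex.Im R \o u) (complex.Im (v x))).

Lemma complex_deriveD u1 v1 u2 v2 : complex_derive u1 v1 -> complex_derive u2 v2 ->
  complex_derive (fun x => u1 x + u2 x) (fun x => v1 x + v2 x).
Proof.
move=> [r1 i1] [r2 i2]; split=> x.
  have -> : @complex.Re R \o (fun x => u1 x + u2 x) =
      (@complex.Re R \o u1) + (@complex.Re R \o u2).
    by apply/funext => y /=; rewrite raddfD.
  by rewrite raddfD; have := r1 x; have := r2 x => ? ?; exact: is_deriveD.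
have -> : @complex.Im R \o (fun x => u1 x + u2 x) =
    (@complex.Im R \o u1) + (@complex.Im R \o u2).
  by apply/funext => y /=; rewrite raddfD.
by rewrite raddfD; have := i1 x; have := i2 x => ? ?; exact: is_deriveD.
Qed.

Lemma complex_deriveZ (c : C) u v : complex_derive u v ->
  complex_derive (fun x => c * u x) (fun x => c * v x).
Proof.
case: c => a b [r i]; split=> x.
  have -> : @complex.Re R \o (fun x => (a +i* b)%C * u x) =
      a *: (@complex.Re R \o u) - b *: (@complex.Im R \o u).
    by apply/funext => y /=; rewrite !fctE; case: (u y).
  by apply: (is_derive_eq (is_deriveB (is_deriveZ a (r x)) (is_deriveZ b (i x))));
    case: (v x).
have -> : @complex.Im R \o (fun x => (a +i* b)%C * u x) =
    a *: (@complex.Im R \o u) + b *: (@complex.Re R \o u).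
  by apply/funext => y /=; rewrite !fctE; case: (u y).
by apply: (is_derive_eq (is_deriveD (is_deriveZ a (i x)) (is_deriveZ b (r x))));
  case: (v x).
Qed.

Lemma complex_derive_continuous u v : complex_derive u v ->
  continuous (@complex.Re R \o u) /\ continuous (@complex.Im R \o u).
Proof.
by move=> [r i]; split=> x; apply: differentiable_continuous;
  apply/derivable1_diffP; [have [] := r x|have [] := i x].
Qed.

Lemma derive_integral (f f' : R -> R) x : 0 <= x ->
  (forall y : R, is_derive y 1 f (f' y)) -> continuous f' ->
  f x = f 0 + \int[mu]_(y in `[0, x]) f' y.
Proof.
rewrite le_eqVlt => /predU1P[<- _ _|x0 df cf'].
  by rewrite set_itv1 Rintegral_set1 addr0.
have cf y : {for y, continuous f}.
  by apply: differentiable_continuous; apply/derivable1_diffP; have [] := df y.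
have := @continuous_FTC2 _ f' f 0 x x0.
rewrite /Rintegral => -> /=; first by rewrite addrCA subrr addr0.
- exact: continuous_subspaceT.
- split=> [y _||]; first by have [] := df y.
  + by apply: cvg_at_right_filter; exact: cf.
  + by apply: cvg_at_left_filter; exact: cf.
- by move=> y _; rewrite derive1E; have [_ ->] := df y.
Qed.

Lemma continuous_integrable_itv (f : R -> R) l : continuous f ->
  mu.-integrable `[0, l] (fun x => (f x)%:E).
Proof.
move=> cf; apply: continuous_compact_integrable; first exact: segment_compact.
exact: continuous_subspaceT.
Qed.

(** Differentiability of [v] supplies the continuity needed for its integrability and for the
    fundamental theorem of calculus. *)
Lemma complex_derive_AC l u v w : complex_derive u v -> complex_derive v w ->
  AC_deriv l u v.
Proof.
move=> [ru iu] /complex_derive_continuous[cr ci]; split.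
  by split; apply: continuous_integrable_itv.
move=> x /andP[x0 _].
have := derive_integral x0 ru cr; have := derive_integral x0 iu ci => /=.
rewrite /cintegral; case: (u x) => a b; case: (u 0) => a0 b0 /= -> ->.
by simpc.
Qed.

Let ReB (x y : C) : complex.Re (x - y) = complex.Re x - complex.Re y.
Proof. by case: x => ? ?; case: y. Qed.
Let ImB (x y : C) : complex.Im (x - y) = complex.Im x - complex.Im y.
Proof. by case: x => ? ?; case: y. Qed.

Lemma AC_derivB l u u' v v' : AC_deriv l u u' -> AC_deriv l v v' ->
  AC_deriv l (fun x => u x - v x) (fun x => u' x - v' x).
Proof.
move=> [[ru iu] hu] [[rv iv] hv].
have sub (D : set R) (f g : R -> R) : measurable D ->
    mu.-integrable D (EFin \o f) -> mu.-integrable D (EFin \o g) ->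
    mu.-integrable D (fun x => (f x - g x)%:E).
  by move=> mD fi gi; under eq_fun do rewrite EFinB; exact: integrableB.
split.
  split.
    rewrite (_ : (fun x => _) =
        (fun x => (complex.Re (u' x) - complex.Re (v' x))%:E)); first exact: sub.
    by apply/funext => y; rewrite ReB.
  rewrite (_ : (fun x => _) =
      (fun x => (complex.Im (u' x) - complex.Im (v' x))%:E)); first exact: sub.
  by apply/funext => y; rewrite ImB.
move=> x x0l; rewrite hu // hv //.
have sb : `[0, x] `<=` `[0, l].
  by move: x0l => /andP[_ xl] y /=; rewrite !in_itv /= => /andP[-> /le_trans->].
have res (f : R -> R) : mu.-integrable `[0, l] (EFin \o f) ->
    mu.-integrable `[0, x] (EFin \o f).
  by apply: integrableS.
have ER : \int[mu]_(y in `[0, x]) complex.Re (u' y - v' y) =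
    \int[mu]_(y in `[0, x]) complex.Re (u' y) - \int[mu]_(y in `[0, x]) complex.Re (v' y).
  rewrite -RintegralB //; [|exact: res|exact: res].
  by apply: eq_Rintegral => y _; rewrite ReB.
have EI : \int[mu]_(y in `[0, x]) complex.Im (u' y - v' y) =
    \int[mu]_(y in `[0, x]) complex.Im (u' y) - \int[mu]_(y in `[0, x]) complex.Im (v' y).
  rewrite -RintegralB //; [|exact: res|exact: res].
  by apply: eq_Rintegral => y _; rewrite ImB.
rewrite /cintegral ER EI.
by case: (u 0) => a b; case: (v 0) => c d; simpc; congr (_ +i* _)%C; ring.
Qed.

End EdgeSolutions.

(** * Existence and uniqueness for the equation on a single edge *)

Section EdgeProblem.
Context {R : realType}.
Notation C := R[i].
Notation mu := (@lebesgue_measure R).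
Implicit Types (s x l M : R) (u v w : R -> C).

Definition spec s : C := (0 +i* s)%C.

(* [cosh_k] and [sinh_k] are cosh (k x) and sinh (k x) / k for a square root k
   of - spec s. *)
Definition cosh_k s x : C := (re_cosh x +i* (- (s * im_cosh x)))%C.
Definition sinh_k s x : C := (re_sinh x +i* (s * im_sinh x))%C.

Lemma cosh_k0 s : cosh_k s 0 = 1.
Proof. by rewrite /cosh_k re_cosh0 im_cosh0 mulr0 oppr0. Qed.

Lemma sinh_k0 s : sinh_k s 0 = 0.
Proof. by rewrite /sinh_k re_sinh0 im_sinh0 mulr0. Qed.

Lemma derive_sinh_k s : complex_derive (sinh_k s) (cosh_k s).
Proof.
split=> x; first exact: derive_re_sinh.
have := derive_im_sinh x => D.
have -> : @complex.Im R \o sinh_k s = s *: im_sinh by [].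
by apply: (is_derive_eq (is_deriveZ s D)) => /=; rewrite scalerN.
Qed.

Lemma derive_cosh_k s : s ^+ 2 = 1 ->
  complex_derive (cosh_k s) (fun x => - (spec s * sinh_k s x)).
Proof.
move=> s2; split=> x.
  have -> : @complex.Re R \o cosh_k s = re_cosh by [].
  have := derive_re_cosh x => D; apply: (is_derive_eq D) => /=.
  by rewrite mul0r add0r opprK mulrA -expr2 s2 mul1r.
have -> : @complex.Im R \o cosh_k s = (- s) *: im_cosh.
  by apply/funext => y; rewrite /= fctE /= /GRing.scale /= mulNr.
have := derive_im_cosh x => D.
by apply: (is_derive_eq (is_deriveZ (- s) D)); rewrite /GRing.scale /=; ring.
Qed.

Lemma wronskian_k s x : s ^+ 2 = 1 ->
  cosh_k s x ^+ 2 + spec s * sinh_k s x ^+ 2 = 1.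
Proof.
move=> s2; rewrite /cosh_k /sinh_k /spec !expr2; simpc.
have := re_wronskian x; have := im_wronskian x; rewrite -!expr2 => E1 E2.
congr (_ +i* _)%C.
  have -> : re_cosh x ^+ 2 - s * im_cosh x * (s * im_cosh x) -
      s * (re_sinh x * (s * im_sinh x) + s * im_sinh x * re_sinh x) =
      re_cosh x ^+ 2 - s ^+ 2 * (im_cosh x ^+ 2 + 2 * re_sinh x * im_sinh x) by ring.
  by rewrite s2 -[RHS]E2; ring.
have -> : - (re_cosh x * (s * im_cosh x)) - s * im_cosh x * re_cosh x +
   s * (re_sinh x ^+ 2 - s * im_sinh x * (s * im_sinh x)) =
   s * (re_sinh x ^+ 2 - s ^+ 2 * im_sinh x ^+ 2 - 2 * re_cosh x * im_cosh x) by ring.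
by rewrite s2 mul1r E1 subrr mulr0.
Qed.

(** Integrating from 0 over a length at most [l] gives a factor [l]; two integrations give the
    factor $l^2$ that drives the contraction in [edge_unique0]. *)
Lemma AC_bound l u u' M : AC_deriv l u u' -> u 0 = 0 ->
  (forall x, 0 <= x <= l ->
    `|complex.Re (u' x)| <= M /\ `|complex.Im (u' x)| <= M) ->
  forall x, 0 <= x <= l ->
    `|complex.Re (u x)| <= M * l /\ `|complex.Im (u x)| <= M * l.
Proof.
move=> [[ri ii] hu] u0 bnd x xl; have /andP[x0 xl'] := xl.
have M0 : 0 <= M by have [h _] := bnd x xl; exact: le_trans h.
have key (f : R -> R) : mu.-integrable `[0, l] (fun x => (f x)%:E) ->
    (forall y, 0 <= y <= l -> `|f y| <= M) ->
    `|\int[mu]_(y in `[0, x]) f y| <= M * l.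
  move=> fi fb.
  have fi' : mu.-integrable `[0, x] (EFin \o f).
    apply: integrableS fi => // y /=; rewrite !in_itv /= => /andP[-> /le_trans->] //.
  apply: le_trans (le_normr_Rintegral _ fi') _ => //.
  apply: le_trans (_ : \int[mu]_(y in `[0, x]) M <= _).
    apply: le_Rintegral => //.
    - exact: (integrable_abse fi').
    - by apply: (@continuous_integrable_itv _ (cst M)); exact: cst_continuous.
    - move=> y /=; rewrite in_itv /= => /andP[y0 yx]; apply: fb.
      by rewrite y0 (le_trans yx).
  have mx : mu `[0, x]%classic = x%:E.
    rewrite lebesgue_measure_itv /= lte_fin.
    case: ltP => [_|x0']; first by rewrite oppr0 adde0.
    by congr EFin; apply/eqP; rewrite eq_le x0.
  rewrite Rintegral_cst // (_ : fine _ = x) ?ler_wpM2l //.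
  by transitivity (fine x%:E) => //; congr fine; exact: mx.
rewrite hu // u0 add0r /=.
by split; apply: key => // y /bnd[].
Qed.

(** The $L^1$ norms of the components of [u'] give a bound from which the contraction can start. *)
Lemma AC_bounded l u u' : AC_deriv l u u' -> u 0 = 0 -> exists M,
  forall x, 0 <= x <= l ->
    `|complex.Re (u x)| <= M /\ `|complex.Im (u x)| <= M.
Proof.
move=> [[ri ii] hu] u0.
have key (f : R -> R) : mu.-integrable `[0, l] (fun x => (f x)%:E) ->
    forall x, 0 <= x <= l ->
    `|\int[mu]_(y in `[0, x]) f y| <= \int[mu]_(y in `[0, l]) `|f y|.
  move=> fi x /andP[x0 xl].
  have sb : `[0, x] `<=` `[0, l].
    by move=> y /=; rewrite !in_itv /= => /andP[-> /le_trans->].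
  have fi' : mu.-integrable `[0, x] (EFin \o f) by apply: integrableS fi.
  apply: le_trans (le_normr_Rintegral _ fi') _ => //.
  rewrite /Rintegral fine_le //.
  - by apply: integrable_fin_num => //; exact: (integrable_abse fi').
  - by apply: integrable_fin_num => //; exact: (integrable_abse fi).
  - apply: ge0_subset_integral => //.
    by have /measurable_int := integrable_abse fi.
exists (\int[mu]_(y in `[0, l]) `|complex.Re (u' y)| +
        \int[mu]_(y in `[0, l]) `|complex.Im (u' y)|) => x xl.
rewrite hu // u0 add0r /=; split.
  by apply: le_trans (key _ ri x xl) _; rewrite lerDl; exact: Rintegral_ge0.
by apply: le_trans (key _ ii x xl) _; rewrite lerDr; exact: Rintegral_ge0.
Qed.

Lemma halving_zero (t M : R) : (forall n, `|t| <= M * (1 / 2) ^+ n) -> t = 0.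
Proof.
move=> h; apply/eqP; rewrite -normr_eq0 eq_le normr_ge0 andbT leNgt.
apply/negP => t0.
have M0 : 0 <= M by have := h 0%N; rewrite expr0 mulr1; exact: le_trans.
have /archi_boundP : 0 <= M / `|t| by rewrite divr_ge0.
set n := Num.bound _ => Mn.
have := h n; rewrite leNgt => /negP; apply.
rewrite expr_div_n expr1n mulrA mulr1 ltr_pdivrMr ?exprn_gt0 //.
rewrite mulrC -ltr_pdivrMr //; apply: (lt_le_trans Mn).
by rewrite -natrX ler_nat ltnW // ltn_expl.
Qed.

(* The solution operator of the integral equation halves bounds on short edges. *)
Lemma edge_unique0 s l w w1 : s ^+ 2 = 1 -> 0 <= l <= 1 / 2 ->
  AC_deriv l w w1 -> AC_deriv l w1 (fun x => - (spec s * w x)) ->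
  w 0 = 0 -> w1 0 = 0 -> forall x, 0 <= x <= l -> w x = 0 /\ w1 x = 0.
Proof.
move=> s2 /andP[l0 l2] ac ac1 w0 w10.
have [M bM] := AC_bounded ac w0.
have sn : `|s| = 1.
  by apply/eqP; rewrite -(@eqrXn2 _ 2) ?expr1n ?real_normK ?num_real ?s2.
(* Multiplication by [- spec s] swaps the components up to sign, so bounds on [w] carry over to the
   derivative of [w1]. *)
have z_bound (K : R) : (forall x, 0 <= x <= l ->
    `|complex.Re (w x)| <= K /\ `|complex.Im (w x)| <= K) ->
    forall x, 0 <= x <= l -> `|complex.Re (- (spec s * w x))| <= K /\
      `|complex.Im (- (spec s * w x))| <= K.
  move=> bK x /bK; case: (w x) => a b /= [ha hb].
  by rewrite !mul0r sub0r opprK add0r normrN !normrM sn !mul1r.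
have bn n : forall x, 0 <= x <= l ->
    `|complex.Re (w x)| <= M * (1 / 2) ^+ n /\
    `|complex.Im (w x)| <= M * (1 / 2) ^+ n.
  elim: n => [|n IH] x xl; first by rewrite expr0 mulr1; exact: bM.
  have := AC_bound ac w0 (AC_bound ac1 w10 (z_bound _ IH)) xl.
  have K0 : 0 <= M * (1 / 2) ^+ n by have [h _] := IH x xl; exact: le_trans h.
  rewrite exprSr [M * (_ * _)]mulrA; move: (M * _) K0 => K K0 [h1 h2].
  have E : K * l * l <= K * (1 / 2) by rewrite -mulrA ler_wpM2l //; nra.
  by split; [apply: le_trans h1 E|apply: le_trans h2 E].
have wz x : 0 <= x <= l -> w x = 0.
  move=> xl; have := halving_zero (fun n => (bn n x xl).1).
  by have := halving_zero (fun n => (bn n x xl).2); case: (w x) => a b /= -> ->.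
move=> x xl; split; first exact: wz.
have zb y : 0 <= y <= l -> `|complex.Re (- (spec s * w y))| <= 0 /\
    `|complex.Im (- (spec s * w y))| <= 0.
  by move=> yl; rewrite wz // mulr0 oppr0 /= normr0.
have := AC_bound ac1 w10 zb xl; rewrite mul0r !normr_le0.
by case: (w1 x) => a b /= [/eqP -> /eqP ->].
Qed.

(** [p] and [d] are the value and the derivative at 0. *)
Definition edge_sol s (p d : C) x : C := p * cosh_k s x + d * sinh_k s x.
Definition edge_sol' s (p d : C) x : C :=
  d * cosh_k s x - p * (spec s * sinh_k s x).

Lemma derive_edge_sol s p d : s ^+ 2 = 1 ->
  complex_derive (edge_sol s p d) (edge_sol' s p d) /\
  complex_derive (edge_sol' s p d) (fun x => - (spec s * edge_sol s p d x)).
Proof.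
move=> s2; have dC := derive_cosh_k s2; have dS := derive_sinh_k s.
split.
  have := complex_deriveD (complex_deriveZ p dC) (complex_deriveZ d dS).
  congr complex_derive; apply/funext => x; rewrite /edge_sol'; ring.
have := complex_deriveD (complex_deriveZ d dC)
  (complex_deriveZ (- (p * spec s)) dS).
congr complex_derive; apply/funext => x; rewrite /edge_sol /edge_sol'; ring.
Qed.

Lemma edge_sol_AC s p d l : s ^+ 2 = 1 ->
  AC_deriv l (edge_sol s p d) (edge_sol' s p d) /\
  AC_deriv l (edge_sol' s p d) (fun x => - (spec s * edge_sol s p d x)).
Proof.
move=> s2; have [D1 D2] := derive_edge_sol p d s2.
split; first exact: complex_derive_AC D1 D2.
apply: complex_derive_AC D2 _.
have := complex_deriveZ (- spec s) D1.
by congr complex_derive; apply/funext => x; rewrite mulNr.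
Qed.

(** Subtracting the explicit solution with the same data at 0 reduces this to [edge_unique0]. *)
Lemma edge_unique s l u u1 : s ^+ 2 = 1 -> 0 <= l <= 1 / 2 ->
  AC_deriv l u u1 -> AC_deriv l u1 (fun x => - (spec s * u x)) ->
  forall x, 0 <= x <= l ->
    u x = edge_sol s (u 0) (u1 0) x /\ u1 x = edge_sol' s (u 0) (u1 0) x.
Proof.
move=> s2 l2 ac ac1 x xl.
have [E1 E2] := edge_sol_AC (u 0) (u1 0) l s2.
have A1 := AC_derivB ac E1; have A2 := AC_derivB ac1 E2.
have A2' : AC_deriv l (fun x => u1 x - edge_sol' s (u 0) (u1 0) x)
    (fun x => - (spec s * (u x - edge_sol s (u 0) (u1 0) x))).
  by move: A2; congr AC_deriv; apply/funext => y; ring.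
have [] := edge_unique0 s2 l2 A1 A2' _ _ xl.
- by rewrite /edge_sol cosh_k0 sinh_k0 mulr1 mulr0 addr0 subrr.
- by rewrite /edge_sol' cosh_k0 sinh_k0 !mulr1 !mulr0 subr0 subrr.
by move=> /eqP; rewrite subr_eq0 => /eqP -> /eqP; rewrite subr_eq0 => /eqP ->.
Qed.

End EdgeProblem.

(** * Estimates of the coefficients of the discrete equation *)

Section ComplexModulus.
Context {R : realType}.
Implicit Types z w : R[i].

Lemma normc_leD z w : normc (z + w) <= normc z + normc w.
Proof. exact: (@le_normcD R). Qed.

Lemma normc_opp z : normc (- z) = normc z.
Proof. exact: (@normcN R). Qed.

Lemma normc_ge0 z : 0 <= normc z.
Proof. by case: z => a b; exact: sqrtr_ge0. Qed.

Lemma normc_leB z w : normc (z - w) <= normc z + normc w.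
Proof. by rewrite -(normc_opp w); exact: normc_leD. Qed.

Lemma normc_sum (I : Type) (r : seq I) (P : pred I) (F : I -> R[i]) :
  normc (\sum_(i <- r | P i) F i) <= \sum_(i <- r | P i) normc (F i).
Proof.
elim/big_rec2: _ => [|i x y _ IH]; first by rewrite normc0.
by apply: le_trans (normc_leD _ _) _; rewrite lerD2l.
Qed.

Lemma abs2E z : abs2 z = normc z ^+ 2.
Proof. by case: z => a b; rewrite /abs2 /= sqr_sqrtr // addr_ge0 ?sqr_ge0. Qed.

Lemma Re_le_normc z : complex.Re z <= normc z.
Proof.
case: z => a b /=; apply: le_trans (ler_norm a) _.
by rewrite -sqrtr_sqr ler_wsqrtr // lerDl sqr_ge0.
Qed.

Lemma normc_le (M : R) z : 0 <= M -> abs2 z <= M ^+ 2 -> normc z <= M.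
Proof. by move=> M0; rewrite abs2E ler_sqr // nnegrE normc_ge0. Qed.

Lemma Re_sum (I : Type) (r : seq I) (P : pred I) (F : I -> R[i]) :
  complex.Re (\sum_(i <- r | P i) F i) = \sum_(i <- r | P i) complex.Re (F i).
Proof. by elim/big_rec2: _ => [//|i x y _ <-]; case: (F i) => ? ?; case: y. Qed.

Lemma Re_gt0_neq0 z : 0 < complex.Re z -> z != 0.
Proof. by move=> h; apply: contraTneq h => ->; rewrite ltxx. Qed.

End ComplexModulus.

(** * The Dirichlet-to-Neumann coefficients of a short edge *)

Section Conductances.
Context {R : realType}.
Implicit Types (s x : R).

Definition off_coef s x : R[i] := (sinh_k s x)^-1.
Definition diag_coef s x : R[i] := cosh_k s x / sinh_k s x.

Let abs_le_of_sqr (a b : R) : 0 <= b -> a ^+ 2 <= b ^+ 2 -> `|a| <= b.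
Proof.
by move=> b0; rewrite -[a ^+ 2]real_normK ?num_real // ler_sqr ?nnegrE.
Qed.

(** For $x\le1/10$ the errors $2x^2$ and $2x^3$ are at most $2/100$ of $1$ and of $x$. The imaginary
    parts are bounded through their squares, where $s^2=1$ removes [s]. *)
Let short_bounds s x : s ^+ 2 = 1 -> 0 < x <= 1 / 10 ->
  [/\ 98 / 100 * x <= complex.Re (sinh_k s x) <= 102 / 100 * x,
      (complex.Im (sinh_k s x)) ^+ 2 <= (2 / 100 * x) ^+ 2,
      98 / 100 <= complex.Re (cosh_k s x) <= 102 / 100 &
      (complex.Im (cosh_k s x)) ^+ 2 <= (2 / 100) ^+ 2].
Proof.
move=> s2 /andP[x0 x1].
have [|Er Ei] := @sinh_near_id _ x; first lra.
have [|Fr Fi] := @cosh_near1 _ x; first lra.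
have x2 : 2 * x ^+ 2 <= 2 / 100 by nra.
have x3 : 2 * x ^+ 3 <= 2 / 100 * x.
  by rewrite exprSr mulrA ler_wpM2r // ltW.
rewrite /sinh_k /cosh_k /=.
have := le_trans Er x3; have := le_trans Fr x2.
rewrite !ler_norml => /andP[a1 a2] /andP[b1 b2].
split; [lra| |lra|].
  rewrite exprMn s2 mul1r -real_normK ?num_real // ler_sqr ?nnegrE //.
    exact: le_trans Ei x3.
  by nra.
rewrite sqrrN exprMn s2 mul1r -real_normK ?num_real // ler_sqr ?nnegrE //.
exact: le_trans Fi x2.
Qed.

Lemma sinh_k_neq0 s x : s ^+ 2 = 1 -> 0 < x <= 1 / 10 -> sinh_k s x != 0.
Proof.
move=> s2 x1; have [/andP[h _] _ _ _] := short_bounds s2 x1.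
by apply: Re_gt0_neq0; apply: lt_le_trans h; rewrite mulr_gt0 //; have := x1; lra.
Qed.

Lemma normc_off_coef s x : s ^+ 2 = 1 -> 0 < x <= 1 / 10 ->
  normc (off_coef s x) <= 2 / x.
Proof.
move=> s2 x1; have [/andP[h _] _ _ _] := short_bounds s2 x1.
have x0 : 0 < x by have := x1; lra.
rewrite /off_coef normcV -[2 / x]invrK invf_div lef_pV2 ?posrE.
- by apply: le_trans (Re_le_normc _); apply: le_trans h; lra.
- by apply: lt_le_trans (Re_le_normc _); apply: lt_le_trans h; lra.
- by rewrite divr_gt0.
Qed.

Lemma Re_off_coef s x : s ^+ 2 = 1 -> 0 < x <= 1 / 10 ->
  (2 * x)^-1 <= complex.Re (off_coef s x).
Proof.
move=> s2 x1; have [] := short_bounds s2 x1; rewrite /off_coef.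
case: (sinh_k s x) => p q /= /andP[p1 p2] q2 _ _.
have x0 : 0 < x by have := x1; lra.
have p0 : 0 < p by nra.
have n0 : 0 < p ^+ 2 + q ^+ 2 by rewrite ltr_pwDl ?exprn_gt0 ?sqr_ge0.
by rewrite ler_pdivlMr // mulrC ler_pdivrMr ?mulr_gt0 //; nra.
Qed.

(** The sign is that of the real part of $C\bar S$, in which the product of the real parts, about
    $x$, dominates the product of the imaginary parts, at most $4\cdot10^{-4}x$. *)
Lemma Re_diag_coef s x : s ^+ 2 = 1 -> 0 < x <= 1 / 10 ->
  0 < complex.Re (diag_coef s x).
Proof.
move=> s2 x1; have [] := short_bounds s2 x1; rewrite /diag_coef.
case: (sinh_k s x) => p q; case: (cosh_k s x) => c d /=.
move=> /andP[p1 p2] q2 /andP[c1 c2] d2.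
have x0 : 0 < x by have := x1; lra.
have p0 : 0 < p by nra.
have n0 : 0 < p ^+ 2 + q ^+ 2 by rewrite ltr_pwDl ?exprn_gt0 ?sqr_ge0.
rewrite mulrN opprK !mulrA -mulrDl divr_gt0 //.
have Hq : `|q| <= 2 / 100 * x by apply: abs_le_of_sqr => //; lra.
have Hd : `|d| <= 2 / 100 by apply: abs_le_of_sqr => //; lra.
have Hdq : `|d * q| <= 2 / 100 * (2 / 100 * x) by rewrite normrM ler_pM.
have := ler_normlW Hdq; rewrite -normrN in Hdq; have := ler_normlW Hdq.
have : 98 / 100 * (98 / 100 * x) <= c * p by rewrite ler_pM //; lra.
lra.
Qed.

Lemma normc_diag_coef s x : s ^+ 2 = 1 -> 0 < x <= 1 / 10 ->
  normc (diag_coef s x) <= 4 / x.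
Proof.
move=> s2 x1; rewrite /diag_coef normcM.
have : normc (cosh_k s x) <= 2.
  have [_ _ /andP[c1 c2] d2] := short_bounds s2 x1.
  by apply: normc_le => //; rewrite /abs2; nra.
have := normc_off_coef s2 x1; rewrite /off_coef => h1 h2.
have -> : 4 / x = 2 * (2 / x) by rewrite mulrA -natrM.
by rewrite ler_pM // normc_ge0.
Qed.

(** The first identity solves for [d]; the second then follows from the Wronskian identity. At
    either end, the derivative into the edge is thus [off_coef] times the far value minus
    [diag_coef] times the near one. *)
Lemma edge_sol_target s p d x : s ^+ 2 = 1 -> 0 < x <= 1 / 10 ->
  d = off_coef s x * edge_sol s p d x - diag_coef s x * p /\
  edge_sol' s p d x = diag_coef s x * edge_sol s p d x - off_coef s x * p.
Proof.
move=> s2 x1; have S0 := sinh_k_neq0 s2 x1.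
have W := wronskian_k x s2.
rewrite /off_coef /diag_coef /edge_sol /edge_sol'.
split; first by field.
have -> : (sinh_k s x)^-1 * p = p *
    ((cosh_k s x ^+ 2 + spec s * sinh_k s x ^+ 2) / sinh_k s x).
  by rewrite W mul1r mulrC.
by field.
Qed.

End Conductances.

(** * The discrete equation, layer by layer *)

Section LayerRecursion.
Context {R : realType}.
Notation C := R[i].
Variable g : nat -> nat.
Hypotheses (g_le : forall i, (g i <= i)%N) (g_idem : forall i, g (g i) = g i).
Variable delta : nat -> R.
Hypotheses (delta_gt0 : forall n, 0 < delta n)
  (delta_small : forall n, 8 * delta n <= 1 / 10)
  (delta_decr : forall n, delta n.+1 <= delta n).
Variable s : R.
Hypothesis s_sqr : s ^+ 2 = 1.
Implicit Types (n i j p q : nat) (phi : nat -> nat -> C) (u up : nat -> C).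

(* [p] and [q] are the groups [g i] and [g j] of the two endpoints of an edge. *)
Definition layer_length n p q : R := if p == q then delta n else 8 * delta n.

Definition off n p q : C := off_coef s (layer_length n p q).
Definition diag n p q : C := diag_coef s (layer_length n p q).

(** The Kirchhoff condition at vertex [i] of sphere [n], whose neighbours are the [n.+2] vertices of
    the next sphere and the [n] vertices of the previous one. At the root the second sum is empty,
    so the truncated [n.-1] is harmless. *)
Definition balanced phi n i :=
  \sum_(j < n.+2) (off n (g i) (g j) * phi n.+1 j - diag n (g i) (g j) * phi n i) -
  \sum_(j < n) (diag n.-1 (g j) (g i) * phi n i - off n.-1 (g j) (g i) * phi n.-1 j)
  = 0.

(** By [offE] below, the coupling between two spheres is the constant [long n] plus [gap n] on equal
    labels: a rank-one term plus a diagonal one on label classes, hence explicitly invertible. *)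
Let long n : C := off_coef s (8 * delta n).
Let gap n : C := off_coef s (delta n) - long n.
Let total_diag n p : C :=
  \sum_(j < n.+2) diag n p (g j) + \sum_(j < n) diag n.-1 (g j) p.
Let count_group n p : nat := \sum_(j < n.+2) (p == g j).
(** Every label class contributes 1 in total, so this is the number of old labels, those other than
    [n.+1]. *)
Let weight n : R := \sum_(j < n.+2 | g j != n.+1) (count_group n (g j))%:R^-1.

Lemma layer_length_bounds n p q : 0 < layer_length n p q <= 1 / 10.
Proof.
rewrite /layer_length; have := delta_gt0 n; have := delta_small n.
by case: eqP => _; lra.
Qed.

Let small1 n : 0 < delta n <= 1 / 10.
Proof. by have := delta_gt0 n; have := delta_small n; lra. Qed.

Let small8 n : 0 < 8 * delta n <= 1 / 10.
Proof. by have := delta_gt0 n; have := delta_small n; lra. Qed.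

Let offE n p q : off n p q = long n + (p == q)%:R * gap n.
Proof.
rewrite /off /layer_length /gap; case: eqP => _; last by rewrite mul0r addr0.
by rewrite mul1r addrC subrK.
Qed.

Let inv_delta8 n : 2 / (8 * delta n) = (delta n)^-1 / 4.
Proof. by field; rewrite gt_eqF ?delta_gt0. Qed.

Let Re_gap n : (4 * delta n)^-1 <= complex.Re (gap n).
Proof.
have := Re_off_coef s_sqr (small1 n).
have := le_trans (Re_le_normc _) (normc_off_coef s_sqr (small8 n)).
rewrite inv_delta8 /gap /long.
case: (off_coef s (delta n)) => a b; case: (off_coef s _) => c d /=.
by rewrite !invfM; lra.
Qed.

Let Re_long n : 0 < complex.Re (long n).
Proof.
apply: lt_le_trans (Re_off_coef s_sqr (small8 n)).
by rewrite invr_gt0 !mulr_gt0.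
Qed.

Let normc_long n : normc (long n) <= (delta n)^-1.
Proof.
apply: le_trans (normc_off_coef s_sqr (small8 n)) _; rewrite inv_delta8.
by have : 0 < (delta n)^-1 by [rewrite invr_gt0]; lra.
Qed.

Let normc_gap n : normc (gap n) <= 3 / delta n.
Proof.
apply: le_trans (normc_leB _ _) _.
have := normc_long n; have := normc_off_coef s_sqr (small1 n); lra.
Qed.

Let normc_off n p q : normc (off n p q) <= 2 / delta n.
Proof.
rewrite /off /layer_length; case: eqP => _; first exact: normc_off_coef.
by have := normc_long n; have : 0 < (delta n)^-1 by [rewrite invr_gt0]; lra.
Qed.

Let normc_diag n p q : normc (diag n p q) <= 4 / delta n.
Proof.
apply: le_trans (normc_diag_coef s_sqr (layer_length_bounds _ _ _)) _.
have d0 := delta_gt0 n.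
rewrite ler_pM2l // lef_pV2 ?posrE //; last first.
  by have /andP[] := layer_length_bounds n p q.
by rewrite /layer_length; case: eqP => _; lra.
Qed.

Let total_diag_neq0 n p : total_diag n p != 0.
Proof.
have pos m p' q' : 0 < complex.Re (diag m p' q').
  by apply: Re_diag_coef => //; exact: layer_length_bounds.
have add (x y : C) : complex.Re (x + y) = complex.Re x + complex.Re y.
  by case: x => ? ?; case: y.
apply: Re_gt0_neq0; rewrite add !Re_sum ltr_pwDl //; last first.
  by apply: sumr_ge0 => j _; exact: ltW.
by rewrite big_ord_recl ltr_pwDl //; apply: sumr_ge0 => j _; exact: ltW.
Qed.

Let gap_neq0 n : gap n != 0.
Proof.
by apply: Re_gt0_neq0; apply: lt_le_trans (Re_gap n); rewrite invr_gt0 mulr_gt0.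
Qed.

Let weight_ge0 n : 0 <= weight n.
Proof. by apply: sumr_ge0 => j _; rewrite invr_ge0 ler0n. Qed.

Let Re_pivot n : (4 * delta n)^-1 <= complex.Re (gap n + long n * (weight n)%:C%C).
Proof.
apply: le_trans (Re_gap n) _; have := mulr_ge0 (ltW (Re_long n)) (weight_ge0 n).
by case: (gap n) => a b; case: (long n) => c d /=; rewrite mulr0 subr0 lerDl.
Qed.

Let pivot_neq0 n : gap n + long n * (weight n)%:C%C != 0.
Proof.
by apply: Re_gt0_neq0; apply: lt_le_trans (Re_pivot n); rewrite invr_gt0 mulr_gt0.
Qed.

Let weightE n : (weight n)%:C%C =
  \sum_(j < n.+2 | g j != n.+1) ((count_group n (g j))%:R : C)^-1.
Proof.
rewrite rmorph_sum; apply: eq_bigr => j _ /=.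
transitivity ((((count_group n (g j))%:R : R)%:C%C)^-1); first exact: fmorphV.
by rewrite (rmorph_nat (real_complex R)).
Qed.

Let sum_off n p u : \sum_(j < n.+2) off n p (g j) * u (g j) =
  long n * \sum_(j < n.+2) u (g j) + gap n * ((count_group n p)%:R * u p).
Proof.
rewrite natr_sum mulr_suml !mulr_sumr -big_split; apply: eq_bigr => j _ /=.
rewrite offE; case: eqP => [->|_]; first by rewrite /= !mul1r mulrDl.
by rewrite /= !mul0r mulr0 !addr0.
Qed.

(** As [g j <= j], only the last vertex can carry the label [n.+1], and it does so exactly when [g]
    fixes [n.+1]. *)
Let split_new n u : \sum_(j < n.+2) u (g j) =
  (if g n.+1 == n.+1 then u n.+1 else 0) +
  \sum_(j < n.+2 | g j != n.+1) u (g j).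
Proof.
rewrite (bigID (fun j : 'I_n.+2 => g j == n.+1)) /=; congr (_ + _).
rewrite big_mkcond big_ord_recr big1 /=; first by case: eqP => [->|]; rewrite add0r.
by move=> j _; rewrite /= ltn_eqF // ltnS (leq_trans (g_le j)) // -ltnS ltn_ord.
Qed.

Let count_neq0 n p : (p <= n)%N -> g p = p -> ((count_group n p)%:R : C) != 0.
Proof.
move=> pn gp; rewrite pnatr_eq0 -lt0n /count_group.
have pn2 : (p < n.+2)%N by rewrite ltnS ltnW.
by rewrite (bigD1 (Ordinal pn2)) //= gp eqxx.
Qed.

Let old_le n j : (j < n.+2)%N -> g j != n.+1 -> (g j <= n)%N.
Proof.
by move=> jn /eqP gj; have := g_le j; lia.
Qed.

Definition layer_rhs n up u p : C :=
  total_diag n p * u p - \sum_(j < n) off n.-1 (g j) p * up (g j).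

(* Summing the equations for the values [u p] of layer [n.+1] over the old
   groups gives a scalar equation for their total [sum_j u (g j)]; its
   coefficient [gap n + long n * weight n] has positive real part. *)
Let next_total n up u (c : C) : C :=
  (gap n * (if g n.+1 == n.+1 then c else 0) +
   \sum_(j < n.+2 | g j != n.+1) layer_rhs n up u (g j) / (count_group n (g j))%:R)
  / (gap n + long n * (weight n)%:C%C).

(** [c] is the free value at a new label. An old label [p] gets the solution of [long n * T + gap n
    * (count_group n p)%:R * u p = rhs], with [T] supplied in advance by [next_total]. *)
Definition next_layer n up u (c : C) p : C :=
  if p == n.+1 then c
  else (layer_rhs n up u p - long n * next_total n up u c) /
       (gap n * (count_group n p)%:R).

(** Consistency of the construction: the total prescribed beforehand is the one attained. Summing
    the solved equations over old labels produces [weight n], and the definition of [next_total]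
    closes the loop. *)
Let next_layer_sum n up u c :
  \sum_(j < n.+2) next_layer n up u c (g j) = next_total n up u c.
Proof.
rewrite split_new {1}/next_layer eqxx; set T := next_total n up u c.
have -> : \sum_(j < n.+2 | g j != n.+1) next_layer n up u c (g j) =
   (\sum_(j < n.+2 | g j != n.+1) layer_rhs n up u (g j) / (count_group n (g j))%:R
    - long n * T * (weight n)%:C%C) / gap n.
  rewrite weightE mulr_sumr -sumrB mulr_suml; apply: eq_bigr => j gj.
  rewrite /next_layer (negbTE gj) -/T.
  have := count_neq0 (old_le (ltn_ord j) gj) (g_idem j).
  move: (count_group n (g j))%:R => k k0; field.
  by rewrite k0 gap_neq0.
have TE : T * (gap n + long n * (weight n)%:C%C) =
   gap n * (if g n.+1 == n.+1 then c else 0) +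
   \sum_(j < n.+2 | g j != n.+1) layer_rhs n up u (g j) / (count_group n (g j))%:R.
  by rewrite /T /next_total divfK // pivot_neq0.
move: TE; set S := \sum_(j < _ | _) _; set nu := if _ then _ else _ => TE.
have -> : S = T * (gap n + long n * (weight n)%:C%C) - gap n * nu.
  by rewrite TE addrC addKr.
by field; exact: gap_neq0.
Qed.

Let next_layerP n up u c p : (p <= n)%N -> g p = p ->
  \sum_(j < n.+2) off n p (g j) * next_layer n up u c (g j) = layer_rhs n up u p.
Proof.
move=> pn gp; rewrite sum_off next_layer_sum /next_layer ltn_eqF //.
have := count_neq0 pn gp; move: (count_group n p)%:R => k k0.
by field; rewrite k0 gap_neq0.
Qed.

(** The recursion has order two, so the previous layer is carried along; before the root it is 0 by
    convention. *)
Fixpoint layers (c : nat -> C) n : (nat -> C) * (nat -> C) :=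
  if n is m.+1 then
    ((layers c m).2, next_layer m (layers c m).1 (layers c m).2 (c m.+1))
  else (fun=> 0, fun=> c 0%N).

Definition layered_sol (c : nat -> C) n i : C := (layers c n).2 (g i).

(** A label [k] first appears at vertex [k] of sphere [k], and its free parameter can be read off
    there. *)
Lemma layered_sol_init c k : g k = k -> layered_sol c k k = c k.
Proof.
by rewrite /layered_sol => gk; case: k gk => [//|k gk] /=; rewrite gk /next_layer eqxx.
Qed.

Let balancedP phi n i : balanced phi n i <->
  \sum_(j < n.+2) off n (g i) (g j) * phi n.+1 j =
  total_diag n (g i) * phi n i - \sum_(j < n) off n.-1 (g j) (g i) * phi n.-1 j.
Proof.
rewrite /balanced /total_diag mulrDl !sumrB !mulr_suml.
set A := \sum_(j < _) off n _ _ * _; set B := \sum_(j < _) diag n _ _ * _.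
set A' := \sum_(j < _) off n.-1 _ _ * _; set B' := \sum_(j < _) diag n.-1 _ _ * _.
split=> [E|->]; last by ring.
by apply/eqP; rewrite -subr_eq0 -[X in _ == X]E; apply/eqP; ring.
Qed.

Lemma layered_sol_balanced c n i : (i <= n)%N -> balanced (layered_sol c) n i.
Proof.
move=> i_n; apply/balancedP; rewrite /layered_sol /=.
rewrite next_layerP ?g_idem //; last exact: leq_trans (g_le i) i_n.
rewrite /layer_rhs; case: n i_n => [|n] i_n /=; first by rewrite !big_ord0.
by [].
Qed.

(** Here [phi] is not assumed constant on label classes; this is derived sphere by sphere. The
    induction keeps two consecutive spheres, as the equation has order two. *)
Lemma balanced_unique phi :
  (forall n i, (i <= n)%N -> balanced phi n i) ->
  (forall k, g k = k -> phi k k = 0) ->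
  forall n i, (i <= n)%N -> phi n i = 0.
Proof.
move=> bal init.
have zero n : (forall i, (i <= n)%N -> phi n i = 0) ->
    (forall i, (i < n)%N -> phi n.-1 i = 0) ->
    forall i, (i <= n.+1)%N -> phi n.+1 i = 0.
  move=> z0 z1.
  (* The equations at [i] and [g i] on sphere [n.+1] have the same sum over the following sphere,
     whatever its values. Sphere [n] vanishes, so comparing the diagonal terms suffices. *)
  have grp i : (i <= n.+1)%N -> phi n.+1 i = phi n.+1 (g i).
    move=> i_n; have gi_n := leq_trans (g_le i) i_n.
    have /balancedP := bal n.+1 i i_n; have /balancedP := bal n.+1 (g i) gi_n.
    rewrite g_idem /= => ->.
    rewrite !big1 => [|j _]; last by rewrite z0 ?mulr0 // -ltnS.
    by rewrite !subr0 => /(mulfI (total_diag_neq0 _ _)).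
  have eq0 p : (p <= n)%N -> g p = p ->
      \sum_(j < n.+2) off n p (g j) * phi n.+1 (g j) = 0.
    move=> pn gp; have /balancedP := bal n p pn; rewrite gp z0 // mulr0 sub0r.
    rewrite [X in - X]big1 ?oppr0; last by move=> j _; rewrite z1 ?mulr0.
    by move=> E; rewrite -[RHS]E; apply: eq_bigr => j _; rewrite [in RHS]grp // -ltnS.
  set T := \sum_(j < n.+2) phi n.+1 (g j).
  have old p : (p <= n)%N -> g p = p ->
      phi n.+1 p = - (long n * T / gap n) / (count_group n p)%:R.
    move=> pn gp; have := eq0 p pn gp; rewrite (sum_off n p (phi n.+1)) -/T.
    have := count_neq0 pn gp; move: (count_group n p)%:R => k k0 E.
    have -> : long n * T = - (gap n * (k * phi n.+1 p)).
      by apply/eqP; rewrite -addr_eq0 E.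
    by field; rewrite k0 gap_neq0.
  have new : (if g n.+1 == n.+1 then phi n.+1 n.+1 else 0) = 0.
    by case: eqP => // /init.
  (* By [old], every old label contributes a multiple of [T]; hence [T] times the nonzero pivot
     [gap n + long n * weight n] is 0. *)
  have T0 : T = 0.
    have : T = - (long n * T / gap n) * (weight n)%:C%C.
      rewrite {1}/T split_new new add0r weightE mulr_sumr.
      by apply: eq_bigr => j gj; apply: old => //; exact: old_le (ltn_ord j) gj.
    move=> TE; apply: (mulIf (pivot_neq0 n)); rewrite mul0r.
    have -> : T * (gap n + long n * (weight n)%:C%C) =
        gap n * (T + long n * T / gap n * (weight n)%:C%C).
      by field; exact: gap_neq0.
    by rewrite {1}TE mulNr addNr mulr0.
  move=> i i_n; rewrite grp //.
  have [gi|gi] := eqVneq (g i) n.+1; last first.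
    by rewrite old ?g_idem ?T0 ?mulr0 ?mul0r ?oppr0 ?mul0r //; exact: old_le gi.
  have i_e : i = n.+1 by move: (g_le i); rewrite gi; lia.
  by rewrite gi; apply: init; rewrite -{1}i_e.
have both n : (forall i, (i <= n)%N -> phi n i = 0) /\
    (forall i, (i < n)%N -> phi n.-1 i = 0).
  elim: n => [|n [IH1 IH2]].
    by split=> // i; rewrite leqn0 => /eqP ->; apply: init;
      apply/eqP; rewrite -leqn0 g_le.
  by split=> [|i]; [exact: zero|rewrite ltnS /=; exact: IH1].
by move=> n; have [] := both n.
Qed.

Lemma balanced_comb phi psi (c : C) n i : balanced phi n i -> balanced psi n i ->
  balanced (fun m j => phi m j - c * psi m j) n i.
Proof.
rewrite /balanced => Ephi Epsi.
have lin k (F G : 'I_k -> C) :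
    \sum_(j < k) (F j - c * G j) = \sum_(j < k) F j - c * \sum_(j < k) G j.
  by rewrite sumrB mulr_sumr.
rewrite (eq_bigr (fun j : 'I_n.+2 =>
    (off n (g i) (g j) * phi n.+1 j - diag n (g i) (g j) * phi n i) -
    c * (off n (g i) (g j) * psi n.+1 j - diag n (g i) (g j) * psi n i))); last first.
  by move=> j _; ring.
rewrite [X in _ - X](eq_bigr (fun j : 'I_n =>
    (diag n.-1 (g j) (g i) * phi n i - off n.-1 (g j) (g i) * phi n.-1 j) -
    c * (diag n.-1 (g j) (g i) * psi n i - off n.-1 (g j) (g i) * psi n.-1 j)));
  last by move=> j _; ring.
rewrite !lin; move/eqP: Ephi; move/eqP: Epsi; rewrite !subr_eq0 => /eqP -> /eqP ->.
by rewrite subrr.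
Qed.

Lemma balanced_sum (I : Type) (r : seq I) phi (F : I -> nat -> nat -> C)
    (c : I -> C) n i :
  balanced phi n i -> (forall k, balanced (F k) n i) ->
  balanced (fun m j => phi m j - \sum_(k <- r) c k * F k m j) n i.
Proof.
move=> bphi bF; elim: r => [|k r IH].
  by move: bphi; congr balanced; apply/funext => m; apply/funext => j;
    rewrite big_nil subr0.
have := balanced_comb (c k) IH (bF k).
congr balanced; apply/funext => m; apply/funext => j.
by rewrite big_cons opprD addrA addrAC.
Qed.

Fixpoint growth n : R := if n is m.+1 then 250 * (m.+2)%:R ^+ 2 * growth m else 1.

(** All coefficients are $O(1/\delta_n)$, those towards the previous sphere because [delta]
    decreases, and the inverses of the gap and of the pivot are at most $4\delta_n$, so $\delta_n$
    cancels. The constant 250 rounds up $40+208$. *)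
Let next_layer_bound n up u (c : C) (M : R) : 0 <= M ->
  (forall p, normc (up p) <= M) -> (forall p, normc (u p) <= M) -> normc c <= M ->
  forall p, normc (next_layer n up u c p) <= 250 * (n.+2)%:R ^+ 2 * M.
Proof.
move=> M0 upM uM cM p; set m : R := (n.+2)%:R.
have m1 : 1 <= m by rewrite ler1n.
have d0 := delta_gt0 n; set h := (delta n)^-1.
have h0 : 0 < h by rewrite invr_gt0.
have sum_bound k (F : 'I_k -> C) (K : R) : (forall j : 'I_k, normc (F j) <= K) ->
    normc (\sum_(j < k) F j) <= k%:R * K.
  move=> FK; apply: le_trans (normc_sum _ _ _) _.
  apply: le_trans (ler_sum _ (fun (j : 'I_k) _ => FK j)) _.
  by rewrite sumr_const card_ord mulr_natl.
have hprev : (0 < n)%N -> (delta n.-1)^-1 <= h.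
  by case: n d0 {m m1} @h h0 => // k *; rewrite lef_pV2 ?posrE.
have n_m : n%:R <= m by rewrite ler_nat leqW.
have rhsM q : normc (layer_rhs n up u q) <= 10 * m * h * M.
  apply: le_trans (normc_leB _ _) _; rewrite normcM.
  have T1 : normc (total_diag n q) <= 8 * m * h.
    apply: le_trans (normc_leD _ _) _.
    have H1 := sum_bound _ _ _ (fun j : 'I_n.+2 => normc_diag n q (g j)).
    have H2 : normc (\sum_(j < n) diag n.-1 (g j) q) <= n%:R * (4 * h).
      apply: sum_bound => j; apply: le_trans (normc_diag _ _ _) _.
      by rewrite ler_pM2l // hprev // (leq_ltn_trans _ (ltn_ord j)).
    have H3 : n%:R * (4 * h) <= m * (4 * h) by rewrite ler_wpM2r // mulr_ge0 // ltW.
    by apply: le_trans (lerD H1 (le_trans H2 H3)) _; rewrite -/m -/h; lra.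
  have T2 : normc (\sum_(j < n) off n.-1 (g j) q * up (g j)) <= n%:R * (2 * h * M).
    apply: sum_bound => j; rewrite normcM ler_pM ?normc_ge0 //.
    apply: le_trans (normc_off _ _ _) _.
    by rewrite ler_pM2l // hprev // (leq_ltn_trans _ (ltn_ord j)).
  have T3 : n%:R * (2 * h * M) <= m * (2 * h * M).
    by rewrite ler_wpM2r // !mulr_ge0 // ltW.
  have T4 : normc (total_diag n q) * normc (u q) <= 8 * m * h * M.
    by rewrite ler_pM ?normc_ge0.
  by apply: le_trans (lerD T4 (le_trans T2 T3)) _; lra.
have mh0 : 0 <= m * h * M by rewrite !mulr_ge0 // ?ltW // (lt_le_trans ltr01).
(* An empty class is covered by the convention $0^{-1}=0$. *)
have inv_count q : ((count_group n q)%:R : R)^-1 <= 1.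
  by case: (count_group n q) => [|k]; rewrite ?invr0 // invf_le1 ?ler1n ?ltr0n.
have normc_nat k : normc (k%:R : C) = k%:R.
  rewrite -(rmorph_nat (real_complex R)) /= expr0n /= addr0 sqrtr_sqr.
  by rewrite ger0_norm.
have inv4 (z : C) : (4 * delta n)^-1 <= complex.Re z -> normc z^-1 <= 4 * delta n.
  move=> hz; rewrite normcV -[4 * _]invrK lef_pV2 ?posrE ?invr_gt0 ?mulr_gt0 //.
    exact: le_trans hz (Re_le_normc z).
  by apply: lt_le_trans (le_trans hz (Re_le_normc z)); rewrite invr_gt0 mulr_gt0.
(* The constant comes from $4(3+10m^2)\le52m^2$. *)
have totM : normc (next_total n up u c) <= 52 * m ^+ 2 * M.
  rewrite /next_total normcM.
  have S1 : normc (\sum_(j < n.+2 | g j != n.+1)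
      layer_rhs n up u (g j) / (count_group n (g j))%:R) <= m * (10 * m * h * M).
    rewrite big_mkcond; apply: sum_bound => j; case: ifP => _; last first.
      by rewrite normc0; lra.
    rewrite normcM normcV normc_nat -[leRHS]mulr1.
    by rewrite ler_pM ?normc_ge0 // invr_ge0 ler0n.
  have S2 : normc (gap n * (if g n.+1 == n.+1 then c else 0)) <= 3 * h * M.
    by rewrite normcM ler_pM ?normc_ge0 ?normc_gap //; case: ifP => _ //; rewrite normc0.
  have S3 := inv4 _ (Re_pivot n).
  have S4 := le_trans (normc_leD _ _) (lerD S2 S1).
  have := ler_pM (normc_ge0 _) (normc_ge0 _) S4 S3.
  move/le_trans; apply.
  have -> : (3 * h * M + m * (10 * m * h * M)) * (4 * delta n) =
     (12 * M + 40 * m ^+ 2 * M) * (h * delta n) by ring.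
  rewrite /h mulVf ?gt_eqF // mulr1.
  have : M <= m ^+ 2 * M by rewrite ler_peMl // exprn_ege1.
  by lra.
have mM : m * M <= m ^+ 2 * M by rewrite ler_wpM2r // expr2 ler_peMr // (le_trans ler01).
have M2 : M <= m * M by rewrite ler_peMl.
rewrite /next_layer; case: eqP => _; first by apply: le_trans cM _; lra.
rewrite invfM normcM normcM (normcV (_%:R)) normc_nat.
have N1 : normc (layer_rhs n up u p - long n * next_total n up u c) <=
    10 * m * h * M + h * (52 * m ^+ 2 * M).
  apply: le_trans (normc_leB _ _) _; rewrite lerD // normcM ler_pM ?normc_ge0 //.
have N2 : normc (gap n)^-1 * ((count_group n p)%:R)^-1 <= 4 * delta n * 1.
  by rewrite ler_pM ?normc_ge0 ?invr_ge0 ?ler0n // inv4.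
have := ler_pM (normc_ge0 _) (mulr_ge0 (normc_ge0 _) _) N1 N2.
rewrite invr_ge0 ler0n => /(_ isT)/le_trans; apply.
have -> : (10 * m * h * M + h * (52 * m ^+ 2 * M)) * (4 * delta n * 1) =
   (40 * (m * M) + 208 * m ^+ 2 * M) * (h * delta n) by ring.
by rewrite /h mulVf ?gt_eqF // mulr1; lra.
Qed.

Lemma growth_ge1 n : 1 <= growth n.
Proof.
elim: n => //= n IH; have m1 : (1 : R) <= n.+2%:R ^+ 2 by rewrite exprn_ege1 ?ler1n.
by rewrite -mulrA; apply: le_trans (_ : n.+2%:R ^+ 2 * growth n <= _); nra.
Qed.

Lemma growth_gt0 n : 0 < growth n.
Proof. exact: lt_le_trans (growth_ge1 n). Qed.

Lemma growthS_ge n : 250 * n.+2%:R ^+ 2 <= growth n.+1.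
Proof. by rewrite /= ler_peMr ?growth_ge1 // mulr_ge0 // exprn_ge0. Qed.

Lemma growthS_ge1000 n : 1000 <= growth n.+1.
Proof.
apply: le_trans (growthS_ge n).
have : (2 : R) <= n.+2%:R by rewrite ler_nat.
by nra.
Qed.

Lemma growth_mono n : growth n <= growth n.+1.
Proof.
rewrite /= ler_peMl ?(ltW (growth_gt0 n)) //.
have : (2 : R) <= n.+2%:R by rewrite ler_nat.
by nra.
Qed.

Lemma growth_ge_exp n : 2 ^+ n <= growth n.
Proof.
elim: n => [//|n IH]; rewrite exprS /= ler_pM ?exprn_ge0 //.
have : (2 : R) <= n.+2%:R by rewrite ler_nat.
by nra.
Qed.

Lemma layered_sol_bound c n i : (forall k, normc (c k) <= 1) ->
  normc (layered_sol c n i) <= growth n.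
Proof.
move=> c1; suff : forall p, normc ((layers c n).1 p) <= growth n /\
    normc ((layers c n).2 p) <= growth n by move=> /(_ (g i))[].
elim: n => [|n IH] p; first by split; [rewrite [X in X <= _](@normc0 R)|exact: c1].
have g1 := growth_ge1 n; have g0 : 0 <= growth n by apply: le_trans g1.
split=> /=; last first.
  apply: next_layer_bound => //; [by move=> q; have [] := IH q|by move=> q; have [] := IH q|].
  exact: le_trans (c1 _) g1.
apply: le_trans (IH p).2 _; rewrite ler_peMl //.
by have : (1 : R) <= n.+2%:R ^+ 2 by [rewrite exprn_ege1 ?ler1n]; lra.
Qed.

End LayerRecursion.

(** * Kernels on the antitree *)

Section AntitreeKirchhoff.
Context {R : realType}.
Notation C := R[i].
Notation mu := (@lebesgue_measure R).
Notation A := (antitree (fun n : nat => n.+1)).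
Variable g : nat -> nat.
Implicit Types (e : edge A) (n k : nat).

Definition mkV n (i : 'I_n.+1) : vertex A := @Tagged nat n (fun n => 'I_n.+1) i.
Definition mkE n (i : 'I_n.+1) (j : 'I_n.+2) : edge A :=
  @Tagged nat n (fun n => ('I_n.+1 * 'I_n.+2)%type) (i, j).

(* [growth] bounds the layered solutions whatever the lengths are, so a fixed
   negative power of it makes all of them square integrable. *)
Definition delta n : R := (@growth R n.+1 ^+ 4)^-1.

Lemma delta_gt0 n : 0 < delta n.
Proof. by rewrite invr_gt0 exprn_gt0 ?growth_gt0. Qed.

Lemma delta_small n : 8 * delta n <= 1 / 10.
Proof.
rewrite ler_pdivrMr ?exprn_gt0 ?growth_gt0 //.
have := @growthS_ge1000 R n; move: (growth _) => x x1.
have : 1000 <= x ^+ 4; last by lra.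
have -> : x ^+ 4 = x * x ^+ 3 by rewrite -exprS.
have x1' : 1 <= x by lra.
by apply: (le_trans x1); rewrite ler_peMr ?exprn_ege1 ?(le_trans ler01).
Qed.

Lemma delta_decr n : delta n.+1 <= delta n.
Proof.
rewrite lef_pV2 ?posrE ?exprn_gt0 ?growth_gt0 //.
by rewrite lerXn2r ?nnegrE ?(ltW (growth_gt0 _)) //; exact: growth_mono.
Qed.

Definition edge_length e : R :=
  layer_length delta (tag e) (g (tagged e).1) (g (tagged e).2).

Lemma edge_length_bounds e : 0 < edge_length e <= 1 / 10.
Proof. exact: layer_length_bounds delta_gt0 delta_small _ _ _. Qed.

Let fsum_ord n (F : 'I_n -> C) : \sum_(j \in [set: 'I_n]) F j = \sum_(j < n) F j.
Proof.
have -> : [set: 'I_n] = [set` enum 'I_n].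
  by apply/seteqP; split=> x //= _; rewrite mem_enum.
by rewrite -fsbig_seq ?enum_uniq // big_enum.
Qed.

Lemma sum_src n (i : 'I_n.+1) (F : edge A -> C) :
  \sum_(e \in [set e | src e = mkV i]) F e = \sum_(j < n.+2) F (mkE i j).
Proof.
rewrite -fsum_ord (reindex_fsbig (mkE i) [set: 'I_n.+2]) //.
split=> [j _ //|j j' _ _|[m [a b]] /=].
  by move=> /eqP; rewrite eq_Tagged => /eqP [].
move=> E; have /= Em := congr1 tag E; subst m.
move: E => /eqP; rewrite eq_Tagged => /eqP /= ->.
by exists b.
Qed.

Lemma sum_tgt0 (i : 'I_1) (F : edge A -> C) :
  \sum_(e \in [set e | tgt e = mkV i]) F e = 0.
Proof.
rewrite (_ : [set e | _] = set0) ?fsbig_set0 //.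
by apply/seteqP; split=> e //= /(congr1 tag).
Qed.

Lemma sum_tgtS n (i : 'I_n.+2) (F : edge A -> C) :
  \sum_(e \in [set e | tgt e = mkV i]) F e = \sum_(j < n.+1) F (mkE j i).
Proof.
rewrite -fsum_ord (reindex_fsbig (fun j => mkE j i) [set: 'I_n.+1]) //.
split=> [j _ //|j j' _ _|[m [a b]] /=].
  by move=> /eqP; rewrite eq_Tagged => /eqP [].
move=> E; have /= [Em] := congr1 tag E; subst m.
move: E => /eqP; rewrite eq_Tagged => /eqP /= ->.
by exists a.
Qed.

(** For [i > n] the index defaults to vertex 0 of the sphere, so statements about these values are
    restricted to [i <= n]. *)
Definition layer_values (phi : vertex A -> C) n i : C := phi (mkV (@inord n i)).

Definition src_deriv s (phi : vertex A -> C) e : C :=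
  off_coef s (edge_length e) * phi (tgt e) - diag_coef s (edge_length e) * phi (src e).

(** Edges point away from the root: those starting at the vertex give the first sum of [balanced],
    those ending there the second, which is empty at the root. *)
Lemma derivative_sum_layers s (phi : vertex A -> C) (f1 : edge A -> R -> C) :
  (forall e, f1 e 0 = src_deriv s phi e) ->
  (forall e, f1 e (edge_length e) = diag_coef s (edge_length e) * phi (tgt e) -
                                   off_coef s (edge_length e) * phi (src e)) ->
  forall n (i : 'I_n.+1), derivative_sum_at edge_length f1 (mkV i) = 0 <->
    balanced g delta s (layer_values phi) n i.
Proof.
move=> h0 h1 n i; rewrite /derivative_sum_at /balanced sum_src.
have val m (j : 'I_m.+1) : layer_values phi m j = phi (mkV j).
  by rewrite /layer_values inord_val.
have -> : \sum_(j < n.+2) f1 (mkE i j) 0 =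
    \sum_(j < n.+2) (off delta s n (g i) (g j) * layer_values phi n.+1 j -
                     diag delta s n (g i) (g j) * layer_values phi n i).
  by apply: eq_bigr => j _; rewrite h0 !val.
case: n i => [|n] i; first by rewrite sum_tgt0 big_ord0.
rewrite sum_tgtS.
have -> : \sum_(j < n.+1) f1 (mkE j i) (edge_length (mkE j i)) =
    \sum_(j < n.+1) (diag delta s n (g j) (g i) * layer_values phi n.+1 i -
                     off delta s n (g j) (g i) * layer_values phi n j).
  by apply: eq_bigr => j _; rewrite h1 !val.
by [].
Qed.

Definition vertex_ext s (phi : vertex A -> C) : gfun R A :=
  fun e x => edge_sol s (phi (src e)) (src_deriv s phi e) x.

Lemma vertex_ext_src s phi e : vertex_ext s phi e 0 = phi (src e).
Proof. by rewrite /vertex_ext /edge_sol cosh_k0 sinh_k0 mulr1 mulr0 addr0. Qed.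

Lemma vertex_ext_tgt s phi e : s ^+ 2 = 1 ->
  vertex_ext s phi e (edge_length e) = phi (tgt e).
Proof.
move=> s2; have S0 := sinh_k_neq0 s2 (edge_length_bounds e).
by rewrite /vertex_ext /edge_sol /src_deriv /off_coef /diag_coef; field.
Qed.

(** Uniqueness on short edges makes [f] an explicit edge solution, and [edge_sol_target] expresses
    its end derivatives through the vertex values provided by continuity. *)
Lemma kernel_vertex_values s (f : gfun R A) : s ^+ 2 = 1 ->
  ker_shift (max_laplacian edge_length) (spec s) f ->
  exists phi, (forall n i, (i <= n)%N -> balanced g delta s (layer_values phi) n i) /\
    eq_gfun edge_length f (vertex_ext s phi).
Proof.
move=> s2 [_ _ [f1 [H2 K]]].
have /choice[phi phiP] : forall v : vertex A, exists c : C,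
    (forall e, src e = v -> f e 0 = c) /\
    (forall e, tgt e = v -> f e (edge_length e) = c).
  by move=> v; have [[c hc] _] := K v; exists c.
have fs e : f e 0 = phi (src e) by have [h _] := phiP (src e); exact: h.
have ft e : f e (edge_length e) = phi (tgt e) by have [_ h] := phiP (tgt e); exact: h.
have sol e x : 0 <= x <= edge_length e ->
    f e x = edge_sol s (f e 0) (f1 e 0) x /\ f1 e x = edge_sol' s (f e 0) (f1 e 0) x.
  have [ac ac1 _ _] := H2 e; apply: edge_unique => //.
  by have := edge_length_bounds e; lra.
have len e : 0 <= edge_length e <= edge_length e.
  by have := edge_length_bounds e; lra.
have D0 e : f1 e 0 = src_deriv s phi e.
  have [E _] := edge_sol_target (f e 0) (f1 e 0) s2 (edge_length_bounds e).
  have [E1 _] := sol e _ (len e).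
  by rewrite E -E1 fs ft.
exists phi; split; last first.
  by move=> e x xl; have [-> _] := sol e x xl; rewrite /vertex_ext -D0 fs.
move=> n i i_n; have i_n' : (i < n.+1)%N by [].
apply/(derivative_sum_layers D0 _ (Ordinal i_n')); last by have [] := K (mkV (Ordinal i_n')).
move=> e; have [E1 E2] := sol e _ (len e).
have [_ E] := edge_sol_target (f e 0) (f1 e 0) s2 (edge_length_bounds e).
by rewrite E2 E -E1 fs ft.
Qed.

(** Grouping by [tag], at most $(n+1)(n+2)$ edges of [X] join spheres [n] and [n.+1]. *)
Lemma sum_edges_le (t : nat -> R) (X : seq (edge A)) K :
  (forall n, 0 <= t n) -> uniq X -> (forall e, e \in X -> (tag e < K)%N) ->
  \sum_(e <- X) t (tag e) <= \sum_(n < K) t n *+ (n.+1 * n.+2).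
Proof.
move=> t0 uX XK.
have -> : \sum_(e <- X) t (tag e) =
    \sum_(e <- X) \sum_(n < K) (if tag e == n then t n else 0).
  apply: eq_big_seq => e eX; rewrite -big_mkcond.
  by rewrite (big_pred1 (Ordinal (XK e eX))) // => n; rewrite /= eq_sym.
rewrite exchange_big; apply: ler_sum => n _.
rewrite -big_mkcond /= big_const_seq iter_addr_0.
apply: ler_wpMn2l => //.
rewrite -size_filter.
pose L := [seq @Tagged nat n (fun n => ('I_n.+1 * 'I_n.+2)%type) p |
             p <- enum {: 'I_n.+1 * 'I_n.+2}].
have -> : (n.+1 * n.+2)%N = size L.
  by rewrite size_map -cardE card_prod !card_ord.
apply: uniq_leq_size; first exact: filter_uniq.
move=> [m p]; rewrite mem_filter /= => /andP[/eqP E _]; subst m.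
by apply/mapP; exists p => //; rewrite mem_enum.
Qed.

Lemma sum_half_le (K : nat) : \sum_(n < K) (1 / 2 : R) ^+ n <= 2.
Proof.
suff -> : \sum_(n < K) (1 / 2 : R) ^+ n = 2 - 2 * (1 / 2) ^+ K.
  by rewrite lerBlDr lerDl mulr_ge0 // exprn_ge0.
elim: K => [|K IH]; first by rewrite big_ord0 expr0 mulr1 subrr.
by rewrite big_ord_recr /= IH exprS; field.
Qed.

(** With $w$ the growth at [n.+1], an edge leaving sphere [n] contributes at most
    $(14w)^2\cdot8w^{-4}=Bw^{-2}$. One factor $w^{-1}$ absorbs the number $(n+1)(n+2)$ of edges, the
    other is at most $2^{-n}$. *)
Lemma in_L2_of_bound (f : gfun R A) :
  (forall e, continuous (@complex.Re R \o f e) /\ continuous (@complex.Im R \o f e)) ->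
  (forall e x, 0 <= x <= edge_length e ->
    normc (f e x) <= 14 * growth (tag e).+1) ->
  in_L2 edge_length f.
Proof.
move=> fc fb.
have mf e : cmeasurable `[0, edge_length e] (f e).
  have [cr ci] := fc e; split; apply/measurable_EFinP.
    by have /measurable_int := continuous_integrable_itv (edge_length e) cr.
  by have /measurable_int := continuous_integrable_itv (edge_length e) ci.
split=> //.
pose B : R := 14 ^+ 2 * 8; have B0 : 0 <= B by rewrite mulr_ge0 // exprn_ge0.
pose t n : R := B / @growth R n.+1 ^+ 2.
have t0 n : 0 <= t n by rewrite divr_ge0 // exprn_ge0 // ltW ?growth_gt0.
have te e : (\int[mu]_(x in `[0%R, edge_length e]) (abs2 (f e x))%:E <= (t (tag e))%:E)%E.
  set G : R := 14 * growth (tag e).+1.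
  have /andP[l0 _] := edge_length_bounds e.
  apply: (@le_trans _ _ (\int[mu]_(x in `[0%R, edge_length e]) (cst (G ^+ 2)%:E x))%E).
    apply: ge0_le_integral => //.
    - by move=> x _; rewrite lee_fin addr_ge0 ?sqr_ge0.
    - have [mr mi] := mf e; apply/measurable_EFinP.
      by apply: measurable_funD; apply: measurable_funX.
    - move=> x /=; rewrite in_itv /= lee_fin abs2E => /fb h.
      by rewrite lerXn2r ?nnegrE ?normc_ge0 //; apply: le_trans h; exact: normc_ge0.
  rewrite integral_cst //= lebesgue_measure_itv /= lte_fin l0 oppr0 adde0.
  rewrite -EFinM lee_fin.
  have g0 := @growth_gt0 R (tag e).+1.
  have : edge_length e <= 8 * delta (tag e).
    rewrite /edge_length /layer_length; have := delta_gt0 (tag e).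
    by case: eqP => _; lra.
  rewrite /t /B /G /delta; move: (growth _) g0 (edge_length e) l0 => w w0 l l0 h.
  have -> : 14 ^+ 2 * 8 / w ^+ 2 = (14 * w) ^+ 2 * (8 / w ^+ 4).
    by field; rewrite gt_eqF.
  by rewrite ler_wpM2l ?exprn_ge0 // mulr_ge0 // ltW.
apply: (@le_lt_trans _ _ ((B * 2)%:E)%E); last exact: ltry.
apply: ge_ereal_sup => _ [X [finX _] <-].
rewrite fsbig_finite //=; set L := finmap.enum_fset _.
apply: (@le_trans _ _ (\sum_(e <- L) (t (tag e))%:E)%E).
  by apply: lee_sum => e _; exact: te.
rewrite sumEFin lee_fin.
pose K := (\max_(e <- L) (tag e).+1)%N.
have LK e : e \in L -> (tag e < K)%N by move=> eL; rewrite /K (leq_bigmax_seq e).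
apply: le_trans (sum_edges_le t0 (finmap.fset_uniq _) LK) _.
apply: (@le_trans _ _ (B * \sum_(n < K) (1 / 2 : R) ^+ n)); last first.
  by rewrite ler_wpM2l // sum_half_le.
rewrite mulr_sumr; apply: ler_sum => n _; rewrite /t.
have g0 := @growth_gt0 R n.+1; have g1 := @growth_ge_exp R n.+1.
have E : (n.+1 * n.+2)%:R <= @growth R n.+1.
  apply: le_trans (growthS_ge _); rewrite natrM -[n.+2%:R ^+ 2]/(_ * _) mulrA.
  rewrite ler_wpM2r ?ler0n //.
  have : (n.+1%:R : R) <= n.+2%:R by rewrite ler_nat.
  have : (0 : R) <= n.+1%:R by rewrite ler0n.
  by lra.
rewrite -[leLHS]mulr_natr -[leLHS]mulrA; apply: ler_wpM2l => //.
move: (growth _) g0 g1 E => w w0 w1 wn.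
apply: (@le_trans _ _ w^-1).
  by rewrite expr2 invfM mulrC mulrA ler_piMl ?invr_ge0 ?(ltW w0) // ler_pdivrMr // mul1r.
rewrite div1r exprVn lef_pV2 ?posrE ?exprn_gt0 //; apply: le_trans w1.
by rewrite ler_eXn2l // ltr1n.
Qed.

(** The derivative at the source may be as large as $6M/l$, but it is multiplied by a sinh term of
    size at most $2l$; with the cosh term this gives $2+6\cdot2=14$. *)
Lemma vertex_ext_bound s phi (M : R) e x : s ^+ 2 = 1 ->
  normc (phi (src e)) <= M -> normc (phi (tgt e)) <= M ->
  0 <= x <= edge_length e -> normc (vertex_ext s phi e x) <= 14 * M.
Proof.
move=> s2 Ms Mt /andP[x0 xl]; have l1 := edge_length_bounds e.
set l := edge_length e in xl l1.
have M0 : 0 <= M by apply: le_trans Ms; exact: normc_ge0.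
have x12 : 0 <= x <= 1 / 2 by lra.
have /andP[l0 _] := l1.
have [Er Ei] := sinh_near_id x12; have [Fr Fi] := cosh_near1 x12.
have sn : `|s| = 1.
  by apply/eqP; rewrite -(@eqrXn2 _ 2) ?expr1n ?real_normK ?num_real ?s2.
have sq (a b : R) : `|a| <= b -> a ^+ 2 <= b ^+ 2.
  by move=> ab; rewrite -real_normK ?num_real // lerXn2r ?nnegrE // (le_trans _ ab).
have x2 : 2 * x ^+ 2 <= 2 / 100 by nra.
have x3 : 2 * x ^+ 3 <= 2 / 100 * x by rewrite exprSr mulrA ler_wpM2r.
have nC : normc (cosh_k s x) <= 2.
  apply: normc_le => //; rewrite /abs2 /= sqrrN [(s * _) ^+ 2]exprMn s2 mul1r.
  have := sq _ _ (le_trans Fi x2); have := le_trans Fr x2.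
  by rewrite ler_norml => /andP[]; nra.
have nS : normc (sinh_k s x) <= 2 * l.
  apply: (@le_trans _ _ (2 * x)); last by rewrite ler_pM2l.
  apply: normc_le; first by rewrite mulr_ge0.
  rewrite /abs2 /= [(s * _) ^+ 2]exprMn s2 mul1r.
  have := sq _ _ (le_trans Ei x3); have := le_trans Er x3.
  by rewrite ler_norml => /andP[]; nra.
have nd : normc (src_deriv s phi e) <= 6 * M / l.
  apply: le_trans (normc_leB _ _) _.
  rewrite (normcM (off_coef _ _)) (normcM (diag_coef _ _)).
  have -> : 6 * M / l = 2 / l * M + 4 / l * M by ring.
  apply: lerD; apply: ler_pM; rewrite ?normc_ge0 //.
    exact: normc_off_coef.
  exact: normc_diag_coef.
apply: le_trans (normc_leD _ _) _; rewrite !normcM.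
have -> : 14 * M = M * 2 + 6 * M / l * (2 * l) by field; rewrite gt_eqF.
by rewrite lerD // ler_pM ?normc_ge0.
Qed.

Lemma in_L2_spec s (f : gfun R A) : s ^+ 2 = 1 ->
  in_L2 edge_length f -> in_L2 edge_length (fun e x => spec s * f e x).
Proof.
move=> s2 [mf Lf]; split.
  move=> e; have [mr mi] := mf e; split.
    rewrite (_ : (fun x => _) = (fun x => - s * complex.Im (f e x))).
      exact: measurable_funM.
    by apply/funext => x; case: (f e x) => a b /=; rewrite mul0r sub0r mulNr.
  rewrite (_ : (fun x => _) = (fun x => s * complex.Re (f e x))).
    exact: measurable_funM.
  by apply/funext => x; case: (f e x) => a b /=; rewrite mul0r add0r.
rewrite /L2norm2 (_ : (fun e => _) =
  (fun e => \int[mu]_(x in `[0%R, edge_length e]) (abs2 (f e x))%:E)%E) //.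
apply/funext => e; apply: eq_integral => x _; congr EFin.
case: (f e x) => a b; rewrite /abs2 /= !mul0r sub0r add0r sqrrN !exprMn s2.
by rewrite !mul1r addrC.
Qed.

Lemma vertex_ext_kernel s (phi : vertex A -> C) : s ^+ 2 = 1 ->
  (forall v, normc (phi v) <= growth (tag v)) ->
  (forall n i, (i <= n)%N -> balanced g delta s (layer_values phi) n i) ->
  ker_shift (max_laplacian edge_length) (spec s) (vertex_ext s phi).
Proof.
move=> s2 phib bal.
have L2 : in_L2 edge_length (vertex_ext s phi).
  apply: in_L2_of_bound => e.
    have [D _] := derive_edge_sol (phi (src e)) (src_deriv s phi e) s2.
    exact: complex_derive_continuous D.
  move=> x xl; apply: vertex_ext_bound => //; apply: le_trans (phib _) _ => //.
  exact: growth_mono.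
have L2' := in_L2_spec s2 L2; split=> //.
exists (fun e => edge_sol' s (phi (src e)) (src_deriv s phi e)); split.
  move=> e; have [a1 a2] := edge_sol_AC (phi (src e)) (src_deriv s phi e) (edge_length e) s2.
  split=> //.
    have [m _] := L2'; have [mr mi] := m e; split.
      rewrite (_ : (fun x => _) = (fun x => - complex.Re (spec s * vertex_ext s phi e x))).
        exact: measurable_funN.
      by apply/funext => x; case: (spec s * _).
    rewrite (_ : (fun x => _) = (fun x => - complex.Im (spec s * vertex_ext s phi e x))).
      exact: measurable_funN.
    by apply/funext => x; case: (spec s * _).
  (* The integral over one edge is bounded by the sum over all edges. *)
  have [_ h] := L2'; apply: le_lt_trans h; apply: esum_ge.
  exists [set e]; first by split=> //; exact: finite_set1.
  rewrite fsbig_set1 le_eqVlt; apply/orP; left; apply/eqP.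
  apply: eq_integral => x _; congr EFin.
  by case: (spec s * _) => a b; rewrite /abs2 /= !sqrrN.
move=> [n i]; split.
  exists (phi (mkV i)); split=> e E.
    by rewrite vertex_ext_src; exact: congr1 E.
  by rewrite vertex_ext_tgt //; exact: congr1 E.
apply/(derivative_sum_layers (phi := phi) (s := s)) => [e|e|].
- by rewrite /edge_sol' cosh_k0 sinh_k0 !mulr0 subr0 mulr1.
- have [_ ->] := edge_sol_target (phi (src e)) (src_deriv s phi e) s2 (edge_length_bounds e).
  by rewrite -(vertex_ext_tgt phi e s2).
- by apply: bal; rewrite -ltnS ltn_ord.
Qed.

End AntitreeKirchhoff.

(** * A basis of the kernel, indexed by the fixed points of [g] *)

Section DeficiencySpace.
Context {R : realType}.
Notation C := R[i].
Notation A := (antitree (fun n : nat => n.+1)).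
Variable g : nat -> nat.
Hypotheses (g_le : forall i, (g i <= i)%N) (g_idem : forall i, g (g i) = g i).
Variable s : R.
Hypothesis s_sqr : s ^+ 2 = 1.
Implicit Types (k n i : nat).
Notation delta := (@delta R).
Notation length := (@edge_length R g).
Notation K := (ker_shift (max_laplacian length) (spec s)).

Let profile k n i : C := layered_sol g delta s (fun j => (j == k)%:R) n i.

Definition basis_values k (v : vertex A) : C := profile k (tag v) (tagged v).

Definition basis_fun k : gfun R A := vertex_ext g s (basis_values k).

Let layer_basis k n i : (i <= n)%N -> layer_values (basis_values k) n i = profile k n i.
Proof. by move=> i_n; rewrite /layer_values /basis_values /= inordK. Qed.

(** Only genuine vertices enter the equation, so default values beyond index [m] on sphere [m] do no
    harm. *)
Lemma eq_balanced (phi psi : nat -> nat -> C) n i : (i <= n)%N ->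
  (forall m j, (j <= m)%N -> phi m j = psi m j) ->
  balanced g delta s phi n i -> balanced g delta s psi n i.
Proof.
move=> i_n E; rewrite /balanced => E0; rewrite -[RHS]E0; congr (_ - _); apply: eq_bigr => j _.
  by rewrite !E // -ltnS ltn_ord.
by rewrite !E //; have := ltn_ord j; lia.
Qed.

Lemma basis_fun_kernel k : K (basis_fun k).
Proof.
apply: vertex_ext_kernel => // [v|n i i_n].
  apply: layered_sol_bound => // [n|n|n|j].
  - exact: delta_gt0.
  - exact: delta_small.
  - exact: delta_decr.
  - by case: eqP => _; rewrite ?[X in X <= _](@normc1 R) ?[X in X <= _](@normc0 R).
apply: (@eq_balanced (profile k)) => // [m j jm|]; first by rewrite layer_basis.
apply: layered_sol_balanced => // m; [exact: delta_gt0|exact: delta_small].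
Qed.

(** The basis is dual to evaluation at vertex [i] of sphere [i], reached here as the source of an
    edge. *)
Lemma basis_fun_free n : (forall k, (k < n)%N -> g k = k) ->
  lin_indep length (fun i : 'I_n => basis_fun i).
Proof.
move=> gk c c0 i.
have := c0 (mkE (@ord_max i) ord0) 0; rewrite /lin_comb lexx /=.
have /andP[l0 _] := @edge_length_bounds R g (mkE (@ord_max i) ord0).
move=> /(_ (ltW l0)) E; rewrite -[RHS]E (bigD1 i) //= big1 ?addr0; last first.
  move=> j ji; rewrite /basis_fun vertex_ext_src /basis_values /profile /=.
  by rewrite layered_sol_init ?gk // eq_sym (negbTE (_ : (j != i :> nat))) // mulr0.
rewrite /basis_fun vertex_ext_src /basis_values /profile /=.
by rewrite layered_sol_init ?gk // eqxx mulr1.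
Qed.

(** The coefficients are the values of [phi] at vertex [k] of sphere [k]. The remainder vanishes at
    these vertices for every label, hence everywhere by [balanced_unique]; extension to the edges is
    linear in the vertex values. *)
Lemma basis_fun_span n (f : gfun R A) : (forall k, g k = k -> (k < n)%N) -> K f ->
  exists c : 'I_n -> C, eq_gfun length f (lin_comb c (fun i : 'I_n => basis_fun i)).
Proof.
move=> gn /(kernel_vertex_values s_sqr)[phi [bal fE]].
pose c (k : 'I_n) : C := layer_values phi k k; exists c.
pose psi m j : C := layer_values phi m j - \sum_(k < n) c k * profile k m j.
have psi0 m j : (j <= m)%N -> psi m j = 0.
  apply: (balanced_unique g_le g_idem (@delta_gt0 R) (@delta_small R) s_sqr).
    move=> {}m {}j jm; apply: balanced_sum => [|k]; first exact: bal.
    apply: layered_sol_balanced => // p; [exact: delta_gt0|exact: delta_small].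
  move=> k gk; have kn := gn k gk; rewrite /psi (bigD1 (Ordinal kn)) //= big1.
    by rewrite /profile layered_sol_init // eqxx mulr1 addr0 subrr.
  move=> k' kk'; rewrite /profile layered_sol_init //.
  by rewrite eq_sym (negbTE (_ : (k' != k :> nat))) // mulr0.
have phiE v : phi v = \sum_(k < n) c k * basis_values k v.
  case: v => m j; have jm : (j <= m)%N by rewrite -ltnS ltn_ord.
  have /eqP := psi0 m j jm; rewrite /psi subr_eq0 => /eqP <-.
  by rewrite /layer_values inord_val.
move=> e x xl; rewrite fE // /lin_comb.
have ext u : vertex_ext g s u e x =
    u (src e) * (cosh_k s x - diag_coef s (length e) * sinh_k s x) +
    u (tgt e) * (off_coef s (length e) * sinh_k s x).
  by rewrite /vertex_ext /edge_sol /src_deriv; ring.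
rewrite ext !phiE !mulr_suml -big_split; apply: eq_bigr => k _.
by rewrite /basis_fun ext /=; ring.
Qed.

End DeficiencySpace.

(** * Labellings realizing each dimension *)

Section DeficiencyIndices.
Context {R : realType}.
Notation A := (antitree (fun n : nat => n.+1)).

(** The fixed points of $\min(\cdot,n)$ are $0,\dots,n$, which accounts for the dimension [n.+1]. *)
Lemma has_dim_finite (s : R) n : s ^+ 2 = 1 ->
  let length := @edge_length R (minn^~ n) in
  has_dim length (ker_shift (max_laplacian length) (spec s)) (Some n.+1).
Proof.
move=> s2 length.
have g_le i : (minn i n <= i)%N by exact: geq_minl.
have g_idem i : minn (minn i n) n = minn i n by rewrite -minnA minnn.
exists (fun i => basis_fun (minn^~ n) s i); split.
- by move=> i; apply: basis_fun_kernel.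
- by apply: basis_fun_free => k; rewrite ltnS => /minn_idPl.
- by move=> f Kf; apply: basis_fun_span => // k; rewrite ltnS => /minn_idPl.
Qed.

(** Every index is its own label, so arbitrarily many basis functions are independent. *)
Lemma has_dim_infinite (s : R) : s ^+ 2 = 1 ->
  let length := @edge_length R id in
  has_dim length (ker_shift (max_laplacian length) (spec s)) None.
Proof.
move=> s2 length n; exists (fun i => basis_fun id s i); split.
  by move=> i; apply: basis_fun_kernel.
by apply: basis_fun_free.
Qed.

End DeficiencyIndices.

Theorem theorem7p1 (R : realType) (N : option nat) (hN : N <> Some 0%N) :
  exists ell : edge (antitree (fun n : nat => n.+1)) -> R,
    (forall e, 0 < ell e) /\ min_laplacian_deficiency_indices ell N.
Proof.
have pos g e : 0 < @edge_length R g e by have /andP[] := @edge_length_bounds R g e.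
case: N hN => [[//|n]|] _.
  exists (edge_length (minn^~ n)); split; first exact: pos.
  (* The lengths do not depend on [s], so the same ones serve both spectral parameters. *)
  by split; [apply: (has_dim_finite (s := 1))|apply: (has_dim_finite (s := -1))];
    rewrite ?sqrrN expr1n.
exists (edge_length id); split; first exact: pos.
by split; [apply: (has_dim_infinite (s := 1))|apply: (has_dim_infinite (s := -1))];
  rewrite ?sqrrN expr1n.
Qed.
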